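(* Let $p\in(1,\infty)$ and let $X=(X,d,\mu)$ be a $p$-admissible metric measure space. Let $\theta\ge 0$ and let $S\subset X$ be a closed nonempty set. If $S\in\mathcal{LCR}_\theta(X)$, then $\mathfrak M^{str}_\theta(S)\neq\emptyset$. Conversely, if $\mathfrak M_\theta(S)\neq\emptyset$, then $S\in\mathcal{LCR}_\theta(X)$.
   Context: A metric measure space is a triple $X=(X,d,\mu)$ with $(X,d)$ a complete separable metric space and $\mu$ a Borel regular measure with $0<\mu(B)<\infty$ for every ball $B$ and $\operatorname{supp}\mu=X$. All balls are closed: $B_r(x)=\{y\in X:d(x,y)\le r\}$; for a ball $B=B_r(x)$ and $\lambda>0$, $\lambda B=B_{\lambda r}(x)$ and $r(B)=r$. A measure on $X$ means a nonzero Borel regular locally finite (outer) measure on $X$. $\mu$ is uniformly locally doubling if for every $R>0$, $C_\mu(R):=\sup_{r\in(0,R]}\sup_{x\in X}\mu(B_{2r}(x))/\mu(B_r(x))<\infty$. For $f:X\to\mathbb R$, $\operatorname{lip}f(x)=\limsup_{y\to x}|f(y)-f(x)|/d(x,y)$ if $x$ is an accumulation point of $X$ and $\operatorname{lip}f(x)=0$ otherwise. For a measure $\mathfrak m$, a Borel set $G$ with $0<\mathfrak m(G)<\infty$ and $f\in L^1_{loc}(\mathfrak m)$, $\mathcal E_{\mathfrak m}(f,G)=\inf_{c\in\mathbb R}\frac{1}{\mathfrak m(G)}\int_G|f-c|\,d\mathfrak m$. $X$ supports a weak local $(1,q)$-Poincaré inequality if for every $R>0$ there are $C>0$, $\lambda\ge1$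 such that $\mathcal E_\mu(f,B_r(x))\le C r\big(\frac{1}{\mu(B_{\lambda r}(x))}\int_{B_{\lambda r}(x)}(\operatorname{lip}f)^q\,d\mu\big)^{1/q}$ for all Lipschitz $f:X\to\mathbb R$, all $x\in X$ and $r\in(0,R]$. $X$ is $q$-admissible ($X\in\mathfrak A_q$) if $\mu$ is uniformly locally doubling and $X$ supports a weak local $(1,q)$-Poincaré inequality. Codimensional Hausdorff contents: for $\theta\ge0$, $E\subset X$ and $\delta\in(0,\infty]$, $\mathcal H_{\theta,\delta}(E)=\inf\{\sum_i\mu(B_{r_i}(x_i))/r_i^{\theta}: E\subset\bigcup_iB_{r_i}(x_i),\ r_i<\delta\}$ (infimum over at most countable coverings by balls), and $\mathcal H_\theta(E)=\lim_{\delta\to0}\mathcal H_{\theta,\delta}(E)$. A set $S\subset X$ is lower codimension-$\theta$ content regular, written $S\in\mathcal{LCR}_\theta(X)$, if there is $\lambda>0$ such that $\mathcal H_{\theta,r}(B_r(x)\cap S)\ge\lambda\,\mu(B_r(x))/r^\theta$ for all $x\in S$ and $r\in(0,1]$. Regular sequences of measures: let $\theta\ge0$ and $S\subset X$ be closed and nonempty. A sequence $\{\mathfrak m_k\}_{k=0}^\infty$ of measures on $X$ is $\theta$-regular (with parameter $\epsilon\in(0,1)$), written $\{\mathfrak m_k\}\in\mathfrak M_\theta(S)$, if: (M1) $\operatorname{supp}\mathfrak m_k=S$ for all $k\in\mathbb N_0$; (M2) there is $C_1>0$ with $\mathfrak m_k(B_r(x))\le C_1\mu(B_r(x))/r^\theta$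 for all $k\in\mathbb N_0$, $x\in X$, $r\in(0,\epsilon^k]$; (M3) there is $C_2>0$ with $\mathfrak m_k(B_r(x))\ge C_2\mu(B_r(x))/r^\theta$ for all $k\in\mathbb N_0$, $x\in S$, $r\in[\epsilon^k,1]$; (M4) $\mathfrak m_k=w_k\mathfrak m_0$ with $w_k\in L^\infty(\mathfrak m_0)$, and there is $C_3>0$ with $\epsilon^{\theta j}/C_3\le w_k(x)/w_{k+j}(x)\le C_3$ for $\mathfrak m_0$-a.e. $x\in S$ and all $k,j\in\mathbb N_0$. It is strongly $\theta$-regular, written $\{\mathfrak m_k\}\in\mathfrak M^{str}_\theta(S)$, if in addition (M5) for every Borel set $E\subset S$, $\limsup_{k\to\infty}\mathfrak m_k(B_{\epsilon^k}(x)\cap E)/\mathfrak m_k(B_{\epsilon^k}(x))>0$ for $\mathfrak m_0$-a.e. $x\in E$. *)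

(* Defs.v *)
From HB Require Import structures.
From mathcomp Require Import all_boot all_order all_algebra.
From mathcomp Require Import all_classical all_reals all_analysis.
Set Implicit Arguments. Unset Strict Implicit. Unset Printing Implicit Defensive.
Import Order.TTheory GRing.Theory Num.Theory.
Import numFieldNormedType.Exports.
Local Open Scope classical_set_scope.
Local Open Scope ring_scope.

Section MMS.
Context {R : realType} {dsp : measure_display} {X : measurableType dsp}.
Variable dist : X -> X -> R.

Definition is_metric : Prop :=
  (forall x y, 0 <= dist x y) /\ (forall x y, dist x y = 0 <-> x = y) /\
  (forall x y, dist x y = dist y x) /\
  (forall x y z, dist x z <= dist x y + dist y z).

Definition metric_complete : Prop :=
  forall u : nat -> X,
    (forall e : R, 0 < e -> exists N, forall m n, (N <= m)%N -> (N <= n)%N ->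
        dist (u m) (u n) < e) ->
    exists l, forall e : R, 0 < e -> exists N, forall n, (N <= n)%N -> dist (u n) l < e.

Definition metric_separable : Prop :=
  exists D : set X, countable D /\
    forall x (r : R), 0 < r -> exists y, D y /\ dist x y < r.

Definition cball (x : X) (r : R) : set X := [set y | dist x y <= r].

Definition dopen (U : set X) : Prop :=
  forall x, U x -> exists r : R, 0 < r /\ [set y | dist x y < r] `<=` U.

Definition dclosed (S : set X) : Prop := dopen (~` S).

Definition borel_structure : Prop :=
  (@measurable dsp X) = <<s dopen >>.

Definition supp (m : set X -> \bar R) : set X :=
  [set x | forall r : R, 0 < r -> (0 < m (cball x r))%E].

Definition is_measure_on (m : {measure set X -> \bar R}) : Prop :=
  (exists A, measurable A /\ m A != 0%E) /\
  (forall x, exists r : R, 0 < r /\ (m (cball x r) < +oo)%E).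

Definition metric_measure_space (mu : {measure set X -> \bar R}) : Prop :=
  is_metric /\ metric_complete /\ metric_separable /\ borel_structure /\
  (forall x (r : R), 0 < r -> (0 < mu (cball x r))%E /\ (mu (cball x r) < +oo)%E) /\
  supp mu = setT.

Definition unif_loc_doubling (mu : {measure set X -> \bar R}) : Prop :=
  forall R0 : R, 0 < R0 -> exists C : R, forall (r : R) x, 0 < r -> r <= R0 ->
    (mu (cball x (2 * r)) <= C%:E * mu (cball x r))%E.

Definition is_accumulation (x : X) : Prop :=
  forall r : R, 0 < r -> exists y, y != x /\ dist x y < r.

Definition lip (f : X -> R) (x : X) : \bar R :=
  if `[< is_accumulation x >] then
    ereal_inf [set ereal_sup [set (`|f y - f x| / dist x y)%:E
                              | y in [set y | 0 < dist x y < r]]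
              | r in [set r : R | 0 < r]]
  else 0%E.

Definition lipschitz (f : X -> R) : Prop :=
  exists L : R, forall x y, `|f x - f y| <= L * dist x y.

Definition osc_mean (m : {measure set X -> \bar R}) (f : X -> R) (G : set X) : \bar R :=
  ereal_inf [set (((fine (m G))^-1)%:E * \int[m]_(x in G) (`|f x - c|)%:E)%E
            | c in [set: R]].

Definition poincare (mu : {measure set X -> \bar R}) (q : R) : Prop :=
  forall R0 : R, 0 < R0 -> exists C lam : R, 0 < C /\ 1 <= lam /\
    forall f : X -> R, lipschitz f -> forall x (r : R), 0 < r -> r <= R0 ->
      (osc_mean mu f (cball x r) <=
        (C * r)%:E *
        poweR (((fine (mu (cball x (lam * r))))^-1)%:E *
               \int[mu]_(y in cball x (lam * r)) poweR (lip f y) q) q^-1)%E.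

Definition admissible (mu : {measure set X -> \bar R}) (q : R) : Prop :=
  unif_loc_doubling mu /\ poincare mu q.

Definition codim_ratio (mu : {measure set X -> \bar R}) (theta : R) (x : X) (r : R)
  : \bar R := (mu (cball x r) * ((r `^ theta)^-1)%:E)%E.

Definition hcontent (mu : {measure set X -> \bar R}) (theta delta : R) (E : set X)
  : \bar R :=
  ereal_inf [set s | exists (I : set nat) (c : nat -> X) (rad : nat -> R),
      (forall i, I i -> 0 < rad i < delta) /\
      E `<=` \bigcup_(i in I) cball (c i) (rad i) /\
      s = \esum_(i in I) codim_ratio mu theta (c i) (rad i)].

Definition LCR (mu : {measure set X -> \bar R}) (theta : R) (S : set X) : Prop :=
  exists lam : R, 0 < lam /\ forall x (r : R), S x -> 0 < r -> r <= 1 ->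
    (hcontent mu theta r (cball x r `&` S) >= lam%:E * codim_ratio mu theta x r)%E.

Definition regular_seq (mu : {measure set X -> \bar R}) (theta : R) (S : set X)
    (eps : R) (m : nat -> {measure set X -> \bar R}) : Prop :=
  0 < eps < 1 /\
  (forall k, is_measure_on (m k)) /\
  (* M1 *) (forall k, supp (m k) = S) /\
  (* M2 *) (exists C1 : R, 0 < C1 /\ forall k x (r : R), 0 < r -> r <= eps ^+ k ->
      (m k (cball x r) <= C1%:E * codim_ratio mu theta x r)%E) /\
  (* M3 *) (exists C2 : R, 0 < C2 /\ forall k x (r : R), S x -> eps ^+ k <= r -> r <= 1 ->
      (m k (cball x r) >= C2%:E * codim_ratio mu theta x r)%E) /\
  (* M4 *) (exists w : nat -> X -> R,
      (forall k, measurable_fun setT (w k)) /\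
      (forall k, exists M : R, {ae m 0%N, forall x, `|w k x| <= M}) /\
      (forall k A, measurable A -> (m k A = \int[m 0%N]_(x in A) (w k x)%:E)%E) /\
      (exists C3 : R, 0 < C3 /\ forall k j : nat, {ae m 0%N, forall x, S x ->
          eps `^ (theta * j%:R) / C3 <= w k x / w (k + j)%N x <= C3})).

Definition strongly_regular_seq (mu : {measure set X -> \bar R}) (theta : R)
    (S : set X) (eps : R) (m : nat -> {measure set X -> \bar R}) : Prop :=
  regular_seq mu theta S eps m /\
  (* M5 *) (forall E, measurable E -> E `<=` S ->
     {ae m 0%N, forall x, E x ->
        (0 < limn_esup (fun k : nat =>
           (fine (m k (cball x (eps ^+ k) `&` E)) /
            fine (m k (cball x (eps ^+ k))))%:E))%E}).

End MMS.

(* Main.v *)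
(** Nets of [S] at the scales [eps ^+ k] are organised into a forest.  The balls
    of radius [eps ^+ k / 8] around a node and around all its descendants form a
    cell; cells are nested along the forest and disjoint at each level, so the
    weights h(a) = mu(cell a) / eps^(k theta) satisfy
    "sum of h over the children of a <= h(a) / eps^theta" with no further
    constant.  Let c(a) be the least h-weight of a finite-depth cut below a; then
    c(a) = min(h(a), sum of c over the children), and content regularity gives
    c >= kappa h.  The measure m_k gives the nodes of level k the mass c and splits
    it among children in proportion to c; hence m_k <= c <= h from level k on (M2),
    m_k = c >= kappa h at level k (M3), and m_k is a multiple of
    m_(k+1) on each node a of level k, by the factor c(a) / (sum of c over the
    children), which lies in [eps^theta, 1] (M4).  These measures live on the
    branches of the forest; they are realised as weighted Lebesgue measures on
    nested intervals of the line and pushed to [S] by taking limits of branches.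
    As different branches may have the same limit, the densities w_k come from
    Radon-Nikodym, and (M5) comes from Lebesgue's density theorem on the line.

    Conversely, for eps^(k+1) < r <= eps^k, (M2) bounds m_k on every ball of a
    covering of the part of S in B_r(x), while (M3) for m_(k+1) and (M4) bound
    m_k(B_r(x)) from below. *)
Require Import Defs.
From HB Require Import structures.
From mathcomp Require Import all_boot all_order all_algebra.
From mathcomp Require Import all_classical all_reals all_analysis.
From mathcomp Require Import measurable_realfun ring lra.
Set Implicit Arguments. Unset Strict Implicit. Unset Printing Implicit Defensive.
Import Order.TTheory GRing.Theory Num.Theory.
Import numFieldNormedType.Exports.
Local Open Scope classical_set_scope.
Local Open Scope ring_scope.
(** * Densities and density points *)

Section densities.
Context d (T : measurableType d) (R : realType).
Implicit Types mu nu : {measure set T -> \bar R}.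
Local Open Scope ereal_scope.

(** On a set where [g < f] and [g] is integrable, the comparison of integrals forces the integral of
    [f - g] to vanish, so the set is null. Sigma-finiteness and a bound on [g] cut the exceptional
    set into countably many such pieces. *)
Lemma ae_le_of_le_integral mu (f g : T -> \bar R) :
  sigma_finite setT mu ->
  measurable_fun setT f -> measurable_fun setT g ->
  (forall x, 0 <= f x) -> (forall x, 0 <= g x) ->
  (forall A, measurable A -> \int[mu]_(x in A) f x <= \int[mu]_(x in A) g x) ->
  {ae mu, forall x, f x <= g x}.
Proof.
move=> [F FT mF] mf mg f0 g0 fg.
pose B (n i : nat) := [set x | g x < f x] `&` ([set x | g x <= n%:R%:E] `&` F i).
have mlt : measurable [set x | g x < f x].
  by rewrite -[X in measurable X]setTI; exact: measurable_lte.
have mB n i : measurable (B n i).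
  apply: measurableI => //; apply: measurableI; last by have [] := mF i.
  by rewrite -[X in measurable X]setTI; apply: measurable_lee => //; exact: measurable_cst.
have B0 n i : mu.-negligible (B n i).
  have mfB : measurable_fun (B n i) f by exact: measurable_funTS.
  have mgB : measurable_fun (B n i) g by exact: measurable_funTS.
  have ig : \int[mu]_(x in B n i) g x < +oo.
    apply: (@le_lt_trans _ _ (\int[mu]_(x in B n i) (cst n%:R%:E) x)).
      apply: ge0_le_integral => //.
      by move=> x [_ []].
    rewrite integral_cst// lte_mul_pinfty//.

    apply: le_lt_trans (proj2 (mF i)); apply: le_measure; rewrite ?inE//.
      by have [] := mF i.
    by move=> x [_ []].
  have intg : mu.-integrable (B n i) g.
    apply/integrableP; split => //.
    by under eq_integral do rewrite gee0_abs//.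
  have intf : mu.-integrable (B n i) f.
    apply/integrableP; split => //.
    under eq_integral do rewrite gee0_abs//.
    exact: le_lt_trans (fg _ (mB n i)) ig.
  have fin : \int[mu]_(x in B n i) g x \is a fin_num.
    by rewrite ge0_fin_numE//; apply: integral_ge0.
  have : \int[mu]_(x in B n i) `|f x - g x| = 0.
    apply/eqP; rewrite eq_le integral_ge0 ?andbT//.
    rewrite (@eq_integral _ _ _ _ _ (fun x => f x - g x)); last first.
      move=> x; rewrite inE => -[/= gf _]; rewrite gee0_abs// sube_ge0//.
        exact: ltW.
      by apply/orP; left; rewrite ge0_fin_numE// (lt_le_trans gf)// leey.
    by rewrite integralB// leeBlDr// add0e fg.
  move/(ae_eq_integral_abs mu (mB n i) (emeasurable_funB mfB mgB)).
  apply: negligibleS => x /= [gf [gn Fx]] H; have := H (conj gf (conj gn Fx)).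
  have gfin : g x \is a fin_num by rewrite ge0_fin_numE// (le_lt_trans gn)// ltry.
  by move: gf; rewrite /= -sube_gt0 => + fg0; rewrite fg0 ltxx.
apply: (@negligibleS _ _ _ _ (\bigcup_n \bigcup_i B n i)); last first.
  by apply: negligible_bigcup => n; apply: negligible_bigcup => i; exact: B0.
move=> x /= /negP; rewrite -ltNge => gf.
have : (\bigcup_i F i) x by rewrite -FT.
move=> [i _ Fx].
have gfin : g x \is a fin_num by rewrite ge0_fin_numE// (lt_le_trans gf)// leey.
(* The strict inequality [g x < f x] makes [g x] finite, so a natural number bounds it. *)
exists (Num.bound (fine (g x))) => //; exists i => //; split=> //; split=> //=.
rewrite -(fineK gfin) lee_fin ltW//.
exact: archi_boundP (fine_ge0 (g0 x)).
Qed.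

(** Radon-Nikodym is applied to finite measures: [nu] is restricted to the disjoint pieces of a
    sigma-finite exhaustion and the densities are summed. The bound by [K] makes the sum finite
    almost everywhere, so that a real-valued density exists. *)
Lemma bounded_density mu nu (K : R) :
  sigma_finite setT mu -> (0 <= K)%R ->
  (forall A, measurable A -> nu A <= K%:E * mu A) ->
  exists w : T -> R, [/\ measurable_fun setT w, (forall x, 0 <= w x)%R &
    forall A, measurable A -> nu A = \int[mu]_(x in A) (w x)%:E].
Proof.
move=> sf K0 numu.
have [F FT /all_and2[mF muF]] := sf.
(* The hypothesis [sf] is turned into a sigma-finite structure, over which the Radon-Nikodym
   derivative is stated. *)
pose mixin :=
  @Measure_isSigmaFinite.Axioms_ d T R mu (Measure.class mu) (Measure.class mu) sf.
pose mu' : {sigma_finite_measure set T -> \bar R} :=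
  HB.pack (Measure.sort mu) (Measure.class mu) mixin.
pose E := seqDU F.
have mE k : measurable (E k).
  by apply: measurableD => //; exact: bigsetU_measurable.
have muE k : mu (E k) < +oo.
  by rewrite (le_lt_trans _ (muF k))// le_measure ?inE//; exact: subDsetl.
have nuE k : nu (E k) < +oo.
  by rewrite (le_lt_trans (numu _ (mE k)))// lte_mul_pinfty ?lee_fin.
have UE : \bigcup_i E i = [set: T] by rewrite FT [RHS]seqDU_bigcup_eq.
have tE := trivIset_seqDU F.
pose nu_ j : {finite_measure set T -> \bar R} := mfrestr (mE j) (nuE j).
have H j : nu_ j `<< mu'.
  apply/null_content_dominatesP => A mA /= A0.
  have mAE : measurable (A `&` E j) by exact: measurableI.
  apply/eqP; rewrite eq_le measure_ge0 andbT.
  apply: le_trans (numu _ mAE) _.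
  rewrite (_ : mu (A `&` E j) = 0) ?mule0//.
  apply/eqP; rewrite eq_le measure_ge0 andbT.
  rewrite -[leRHS](A0 : mu A = 0).
  by apply: le_measure; rewrite ?inE.
pose f j := Radon_Nikodym_SigmaFinite.f (nu_ j) mu'.
have f0 j x : 0 <= f j x by exact: Radon_Nikodym_SigmaFinite.f_ge0.
have mf j : measurable_fun setT (f j).
  by apply: measurable_int (Radon_Nikodym_SigmaFinite.f_integrable (H j)).
pose g x := \sum_(0 <= j <oo) f j x.
have g0 x : 0 <= g x by exact: nneseries_ge0.
have mg : measurable_fun setT g.
  rewrite (_ : g = fun x => \sum_(0 <= j <oo | j \in predT) f j x)//.
  exact: ge0_emeasurable_sum.
have gE A : measurable A -> nu A = \int[mu]_(x in A) g x.
  move=> mA; rewrite integral_nneseries//; last by move=> n; exact: measurable_funTS.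
  rewrite -{1}(setIT A) -UE setI_bigcupr measure_bigcup//=; last 2 first.
  - by move=> i _; exact: measurableI.
  - exact: trivIset_setIl.
  rewrite (@eq_eseriesl _ _ predT); last by move=> i; rewrite in_setT.
  apply: eq_eseriesr => j _.
  by rewrite /f -(Radon_Nikodym_SigmaFinite.f_integral (H j)).
have gK : {ae mu, forall x, g x <= K%:E}.
  apply: (@ae_le_of_le_integral mu g (cst K%:E)) => //.
  move=> A mA; rewrite -gE//.
  by rewrite (_ : (fun=> K%:E) = cst K%:E)// integral_cst// numu.
exists (fine \o g); split.
- exact: measurableT_comp.
- by move=> x /=; exact: fine_ge0.
- move=> A mA; rewrite gE//; apply: ge0_ae_eq_integral => //.
  + exact: measurable_funTS.
  + by apply: measurable_funTS; apply/measurable_EFinP; exact: measurableT_comp.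
  + by move=> x _; rewrite lee_fin fine_ge0.
  + apply: filterS gK => x gxK _ /=.
    by rewrite fineK// ge0_fin_numE// (le_lt_trans gxK)// ltry.
Qed.

Variables (mu : {measure set T -> \bar R}) (f : T -> \bar R).
Hypotheses (mf : measurable_fun setT f) (f0 : forall x, 0 <= f x).

(** The two proofs are arguments so that the measure structure declared below can recover them from
    the term. *)
Definition density_measure (_ : measurable_fun setT f) (_ : forall x, 0 <= f x)
  (A : set T) : \bar R := \int[mu]_(x in A) f x.

Let nu := density_measure mf f0.

Let nu0 : nu set0 = 0.
Proof. exact: integral_set0. Qed.

Let nu_ge0 A : 0 <= nu A.
Proof. by apply: integral_ge0 => x _; exact: f0. Qed.

Let nu_sigma_additive : semi_sigma_additive nu.
Proof. exact: semi_sigma_additive_nng_induced. Qed.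

HB.instance Definition _ := isMeasure.Build _ _ _ nu nu0 nu_ge0 nu_sigma_additive.

End densities.

Lemma measurable_fun_countable_pieces d d' (T : measurableType d)
    (U : measurableType d') (I : nat -> set T) (f : T -> U) (v : nat -> U) (u0 : U) :
  (forall i, measurable (I i)) -> (forall i t, I i t -> f t = v i) ->
  (forall t, (forall i, ~ I i t) -> f t = u0) -> measurable_fun setT f.
Proof.
move=> mI fv fu _ Y mY; rewrite setTI.
rewrite (_ : _ @^-1` _ = (\bigcup_(i in [set i | Y (v i)]) I i) `|`
   (if `[< Y u0 >] then ~` (\bigcup_i I i) else set0)); last first.
  apply/seteqP; split => t /=.
    move=> Yt; have [[i It]|nI] := pselect (exists i, I i t).
      by left; exists i => //=; rewrite -(fv _ _ It).
    right; case: asboolP => [_ [i _ It]|]; first by apply: nI; exists i.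
    by apply; rewrite -(fu t)// => i It; apply: nI; exists i.
  move=> [[i /= Yi /fv ->//]|]; case: asboolP => // Y0 nI.
  by rewrite fu// => i It; apply: nI; exists i.
apply: measurableU; first exact: bigcup_measurable.
by case: ifP => // _; apply: measurableC; exact: bigcup_measurable.
Qed.

(** * Density points along nested intervals *)

Section nested_density.
Context {R : realType}.
Local Notation lambda := (@lebesgue_measure R).

(* Decreasing intervals around a density point either shrink to it, or have a
   nondegenerate intersection, which is then contained in [A]. *)
Lemma nested_interval_density (A : set R) : measurable A ->
  {ae lambda, forall t, A t -> forall a b : nat -> R,
    (forall k, a k <= t < b k) ->
    nondecreasing_seq a -> nonincreasing_seq b ->
    (forall u, (forall k, a k <= u < b k) -> A u) ->
    exists N, forall k, (N <= k)%N ->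
      (((b k - a k) / 2)%:E <= lambda (A `&` [set u : R | (a k <= u < b k)%R]))%E}.
Proof.
move=> mA; have := lebesgue_density mA.
apply: negligibleS => t /= + dens; apply => At a b tab ainc bdec Aab.
have itvE k : [set u : R | (a k <= u < b k)%R] = [set` `[a k, b k[].
  by apply/seteqP; split => u /=; rewrite in_itv.
have mitv k : measurable [set u : R | (a k <= u < b k)%R] by rewrite itvE.
have mAI k : measurable (A `&` [set u : R | (a k <= u < b k)%R]).
  exact: (measurableI _ _ mA (mitv k)).
have litv k : lambda [set u : R | (a k <= u < b k)%R] = (b k - a k)%:E.
  rewrite itvE lebesgue_measure_itv/= lte_fin ifT//.
  by have /andP[] := tab k => /le_lt_trans; apply.
(* If the lengths stay above some [e], the limit interval has length at least [e] and its interior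
   branch points lie in [A]; otherwise density at [t] is used. *)
have [small|] := pselect (forall e, 0 < e -> exists k, b k - a k < e); last first.
  move=> /existsNP[e /not_implyP[e0 nsmall]].
  have ebig k : e <= b k - a k.
    by rewrite leNgt; apply/negP => ?; apply: nsmall; exists k.
  have sa : has_sup (range a).
    split; first by exists (a 0%N), 0%N.
    by exists t => _ [k _ <-]; have /andP[] := tab k.
  have ib : has_inf (range b).
    split; first by exists (b 0%N), 0%N.
    by exists t => _ [k _ <-]; have /andP[_ /ltW] := tab k.
  have asup k : a k <= sup (range a) by apply: ub_le_sup; [case: sa|exists k].
  have binf k : inf (range b) <= b k by apply: ge_inf; [case: ib|exists k].
  have [_ [k1 _ <-] k1P] := sup_adherent (divr_gt0 e0 (ltr0n R 2)) sa.
  have [_ [k2 _ <-] k2P] := inf_adherent (divr_gt0 e0 (ltr0n R 2)) ib.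
  have big : e <= inf (range b) - sup (range a).
    rewrite leNgt; apply/negP => lte.
    set z := e - (inf (range b) - sup (range a)).
    have z0 : 0 < z / 2 by rewrite /z; lra.
    have [_ [k3 _ <-] k3P] := sup_adherent z0 sa.
    have [_ [k4 _ <-] k4P] := inf_adherent z0 ib.
    have := ebig (maxn k3 k4).
    have := ainc _ _ (leq_maxl k3 k4); have := bdec _ _ (leq_maxr k3 k4).
    have := asup (maxn k3 k4); have := binf (maxn k3 k4).
    rewrite /z in k3P k4P *; lra.
  (* Each end is within [e / 2] of its limit, and the limit interval has length at least [e], so it
     fills at least half of the current interval. *)
  exists (maxn k1 k2) => k; rewrite geq_max => /andP[kk1 kk2].
  apply: (@le_trans _ _ (lambda [set` `[sup (range a), inf (range b)[])).
    rewrite lebesgue_measure_itv/= lte_fin ifT; last lra.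
    rewrite -EFinB lee_fin.
    by have := ainc _ _ kk1; have := bdec _ _ kk2; lra.
  apply: le_measure; rewrite ?inE//; first exact: mAI.
  have sub u : sup (range a) <= u < inf (range b) -> forall l, a l <= u < b l.
    move=> /andP[au ub] l; rewrite (le_trans (asup l) au)/=.
    exact: lt_le_trans ub (binf l).
  move=> u /=; rewrite in_itv/= => uab; split; first by apply: Aab; exact: sub.
  exact: sub.
(* The deficit [1/8] suits the ball of radius [2 * l] around an interval of length [l]: of its
   measure [4 * l] at most [l / 2] lies outside [A], so [A] keeps half of the interval. *)
move: dens; rewrite indicE mem_set//= => /fine_cvgP[fin] /cvgrPdist_lt/(_ (1/8)) dens.
have {}dens : \forall r \near 0^'+,
   (lambda (A `&` ball t r) >= (r * 7 / 4)%:E)%E.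
  have r80 : 0 < 1 / 8 :> R by lra.
  near=> r.
  have r0 : 0 < r by near: r; exact: nbhs_right_gt.
  have : `|1 - fine (lambda (A `&` ball t r) * (lambda (ball t r))^-1)%E| < 1/8.
    by near: r; exact: dens.
  have mAb : measurable (A `&` ball t r) by apply: measurableI => //; exact: measurable_ball.
  have bE : lambda (ball t r) = (r *+ 2)%:E by rewrite lebesgue_measure_ball// ltW.
  have Afin : lambda (A `&` ball t r) \is a fin_num.
    rewrite ge0_fin_numE//; apply: (@le_lt_trans _ _ (lambda (ball t r))).
      by apply: le_measure; rewrite ?inE//; exact: measurable_ball.
    by rewrite bE ltry.
  rewrite bE -(fineK Afin) inver mulrn_eq0/= gt_eqF// -EFinM/= lee_fin.
  set x := fine _; rewrite ltr_distlC => /andP[+ _].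
  by rewrite ltr_pdivlMr ?mulrn_wgt0// -mulr_natr; lra.
have [e /= e0 eP] := dens.
have [N NP] := small (e / 2) (divr_gt0 e0 (ltr0n R 2)).
exists N => k Nk.
set l := b k - a k.
have l0 : 0 < l by rewrite /l; have /andP[] := tab k; lra.
have le2 : l < e / 2.
  by apply: le_lt_trans NP; rewrite /l; have := ainc _ _ Nk; have := bdec _ _ Nk; lra.
have := eP (2 * l); rewrite /ball/= sub0r normrN gtr0_norm; last by rewrite mulr_gt0.
have l20 : 0 < 2 * l by rewrite mulr_gt0.
move=> /(_ _ l20) H.
have {}H : ((2 * l * 7 / 4)%:E <= lambda (A `&` ball t (2 * l)))%E by apply: H; lra.
set B := ball t (2 * l) in H *.
have mB : measurable B by exact: measurable_ball.
have IB : [set u : R | (a k <= u < b k)%R] `<=` B.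
  move=> u /= /andP[au ub]; rewrite /B /ball/= ltr_distlC.
  by have /andP[] := tab k; rewrite /l; move=> *; apply/andP; split; lra.
have BE : lambda B = (4 * l)%:E.
  by rewrite /B lebesgue_measure_ball ?(ltW l20)//; congr EFin; rewrite -mulr_natr; ring.
have fI : lambda (A `&` [set u : R | (a k <= u < b k)%R]) \is a fin_num.
  rewrite ge0_fin_numE//; apply: (@le_lt_trans _ _ (lambda [set u : R | (a k <= u < b k)%R])).
    by apply: le_measure; rewrite ?inE; [exact: mAI|exact: mitv|].
  by rewrite litv ltry.
have : (lambda (A `&` B) <= lambda (A `&` [set u : R | (a k <= u < b k)%R]) + (3 * l)%:E)%E.
  have BI : lambda (B `\` [set u : R | (a k <= u < b k)%R]) = (3 * l)%:E.
    rewrite measureD; [|exact: mB|exact: mitv|exact: (@le_lt_trans _ _ (4 * l)%:E _ _ (eq_ind_r (fun z => (z <= _)%E) (lexx _) BE) (ltry _))].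
    transitivity ((4 * l)%:E - l%:E)%E.
      by congr (_ - _)%E; [exact: BE|rewrite setIidr//; exact: litv].
    rewrite -EFinB; congr EFin.
    by rewrite /l; ring.
  rewrite -BI.
  have mBI : measurable (B `\` [set u : R | (a k <= u < b k)%R]).
    by apply: measurableD => //; exact: mitv.
  apply: (@le_trans _ _ (lambda ((A `&` [set u : R | (a k <= u < b k)%R]) `|`
      (B `\` [set u : R | (a k <= u < b k)%R])))); last first.
    by apply: measureU2; [exact: mAI|exact: mBI].
  apply: le_measure; rewrite ?inE.
  - exact: measurableI.
  - by apply: measurableU => //; exact: mAI.
  - move=> u [Au Bu]; have [?|?] := pselect ([set u : R | (a k <= u < b k)%R] u).
      by left.
    by right.
move=> /(le_trans H); rewrite -(fineK fI) -EFinD !lee_fin; lra.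
Unshelve. all: by end_near. Qed.

End nested_density.

(** * Countable coverings and geometric scales *)

Lemma measure_le_esum d (T : measurableType d) (R : realType)
    (m : {measure set T -> \bar R}) (I : set nat) (F : nat -> set T) (E : set T)
    (a : nat -> \bar R) (C : R) :
  0 <= C -> (forall i, I i -> measurable (F i)) -> measurable E ->
  E `<=` \bigcup_(i in I) F i ->
  (forall i, I i -> 0 <= a i)%E ->
  (forall i, I i -> m (F i) <= C%:E * a i)%E ->
  (m E <= C%:E * \esum_(i in I) a i)%E.
Proof.
move=> C0 mF mE EF a0 mFa.
pose a' i := if i \in I then a i else 0%E.
have a'0 i : (0 <= a' i)%E.
  by rewrite /a'; case: ifPn => // /[!inE] /a0.
rewrite esum_mkcond -nneseries_esumT// -nneseriesZl; last by move=> i _; exact: a'0.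
pose F' i := if i \in I then F i else set0.
have mF' i : measurable (F' i).
  by rewrite /F'; case: ifPn => // /[!inE] /mF.
apply: (@le_trans _ _ (\sum_(0 <= i <oo) m (F' i))%E).
  apply: measure_sigma_subadditive => //.
  by move=> x /EF[i Ii Fx]; exists i => //; rewrite /F' mem_set.
apply: lee_nneseries => [i *|i *]; first exact: measure_ge0.
rewrite /F' /a'; case: ifPn => [/[!inE] /mFa//|_].
by rewrite measure0 mule0.
Qed.

Lemma exists_expr_lt (R : realType) (e r : R) : 0 < e < 1 -> 0 < r ->
  exists n, e ^+ n < r.
Proof.
move=> /andP[e0 e1] r0; have : `|e| < 1 by rewrite gtr0_norm.
move=> /cvg_expr/cvgrPdist_lt/(_ r r0)[n _ nP]; exists n.
by have := nP n (leqnn n); rewrite /= sub0r normrN gtr0_norm// exprn_gt0.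
Qed.

Lemma geometric_scale (R : realType) (e r : R) : 0 < e < 1 -> 0 < r -> r <= 1 ->
  exists k, e ^+ k.+1 < r <= e ^+ k.
Proof.
move=> e01 r0 r1; have ex := exists_expr_lt e01 r0.
case: (ex_minnP ex) => -[|m] mP mmin.
  by move: mP; rewrite expr0 ltNge r1.
exists m; rewrite mP/= leNgt; apply/negP => /mmin.
by rewrite ltnn.
Qed.

(** * Metric measure spaces *)

Section metric_basics.
Context {R : realType} {dsp : measure_display} {X : measurableType dsp}.
Variables (dist : X -> X -> R) (mu : {measure set X -> \bar R}).
Hypothesis MM : metric_measure_space dist mu.
Local Notation cball := (cball dist).

Lemma distxx x : dist x x = 0.
Proof. by have [[_ [H _]] _] := MM; apply/H. Qed.

Lemma distC x y : dist x y = dist y x.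
Proof. by have [[_ [_ [H _]]] _] := MM. Qed.

Lemma dist_tri y x z : dist x z <= dist x y + dist y z.
Proof. by have [[_ [_ [_ H]]] _] := MM. Qed.

Lemma cball_sub x y r s : dist x y + r <= s -> cball y r `<=` cball x s.
Proof. by move=> h z; rewrite /cball/= => ?; have := dist_tri y x z; lra. Qed.

Lemma dopen_measurable U : dopen dist U -> measurable U.
Proof.
move=> oU; have [_ [_ [_ [-> _]]]] := MM.
exact: sub_sigma_algebra.
Qed.

Lemma dclosed_measurable A : dclosed dist A -> measurable A.
Proof. by move=> /dopen_measurable/measurableC; rewrite setCK. Qed.

Lemma measurable_cball x r : measurable (cball x r).
Proof.
apply: dclosed_measurable => y; rewrite /cball/= => /negP; rewrite -ltNge => h.
exists (dist x y - r); split; first by rewrite subr_gt0.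
move=> z /= h2; apply/negP; rewrite -ltNge.
by have := dist_tri z x y; rewrite (distC z y); lra.
Qed.

Lemma cball_gt0 x r : 0 < r -> (0 < mu (cball x r))%E.
Proof. by have [_ [_ [_ [_ [H _]]]]] := MM; move=> /(H x)[]. Qed.

Lemma cball_lty x r : 0 < r -> (mu (cball x r) < +oo)%E.
Proof. by have [_ [_ [_ [_ [H _]]]]] := MM; move=> /(H x)[]. Qed.

Lemma cball_fin x r : 0 < r -> mu (cball x r) \is a fin_num.
Proof. by move=> r0; rewrite ge0_fin_numE// cball_lty. Qed.

Definition vol x r : R := fine (mu (cball x r)).

Lemma volE x r : 0 < r -> mu (cball x r) = (vol x r)%:E.
Proof. by move=> r0; rewrite fineK// cball_fin. Qed.

Lemma vol_gt0 x r : 0 < r -> 0 < vol x r.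
Proof. by move=> r0; rewrite -lte_fin -volE// cball_gt0. Qed.

Lemma codim_ratioE theta x r : 0 < r ->
  codim_ratio dist mu theta x r = (vol x r / r `^ theta)%:E.
Proof. by move=> r0; rewrite /codim_ratio volE. Qed.

Lemma codim_ratio_ge0 theta x r : (0 <= codim_ratio dist mu theta x r)%E.
Proof. by rewrite /codim_ratio mule_ge0// lee_fin invr_ge0 powR_ge0. Qed.

(** Doubling is iterated until [2 ^+ n] exceeds [L]. Allowing two centres reduces every later
    comparison of balls to linear arithmetic on radii and distances. *)
Lemma vol_doubling (L rmax : R) : unif_loc_doubling dist mu -> 0 < rmax ->
  exists C : R, 0 < C /\ forall x y r r', 0 < r -> r <= rmax -> 0 < r' ->
    dist x y + r' <= L * r -> vol y r' <= C * vol x r.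
Proof.
move=> D rm0.
have [n nL] : exists n, L <= 2 ^+ n.
  exists (Num.bound (`|L|)); apply: le_trans (ler_norm L) _.
  apply: le_trans (ltW (archi_boundP (normr_ge0 L))) _.
  by rewrite -natrX ler_nat ltnW// ltn_expl.
(* The iterated radii can reach [2 ^+ n * rmax], so doubling is invoked up to that scale. *)
have R0 : 0 < 2 ^+ n * rmax by rewrite mulr_gt0// exprn_gt0.
have [C0 C0P] := D _ R0.
pose C := Num.max C0 1.
have C1 : 0 < C by rewrite /C lt_max ltr01 orbT.
have CP i x r : 0 < r -> r <= rmax -> (i <= n)%N -> vol x (2 ^+ i * r) <= C ^+ i * vol x r.
  move=> r0 rr; elim: i => [|i IH] lin; first by rewrite !expr0 !mul1r.
  have ir0 : 0 < 2 ^+ i * r by rewrite mulr_gt0// exprn_gt0.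
  have h : 2 ^+ i * r <= 2 ^+ n * rmax.
    by apply: ler_pM => //; [exact: ltW|rewrite ler_eXn2l ?ltr1n// ltnW].
  have := C0P _ x ir0 h.
  rewrite mulrA -exprS !volE//; last by rewrite mulr_gt0// exprn_gt0.
  rewrite -EFinM lee_fin => /le_trans; apply.
  apply: (@le_trans _ _ (C * vol x (2 ^+ i * r))).
    by apply: ler_wpM2r; [exact/ltW/vol_gt0|rewrite /C le_max lexx].
  by rewrite exprS -mulrA ler_pM2l// IH// ltnW.
exists (C ^+ n); split; first exact: exprn_gt0.
move=> x y r r' r0 rr r'0 h.
apply: le_trans (CP n x r r0 rr (leqnn _)).
have r20 : 0 < 2 ^+ n * r by rewrite mulr_gt0// exprn_gt0.
rewrite -lee_fin -!volE//; apply: le_measure; rewrite ?inE; [exact: measurable_cball..|].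
by apply: cball_sub; apply: le_trans h _; rewrite ler_pM2r.
Qed.

(** A dense sequence of [X] need not meet [S]: its i-th term is replaced, for every [n], by a point
    of [S] within [1 / (n + 1)] of it if there is one, and by [x0] otherwise. Pairs [(i, n)] are
    coded by one index. *)
Lemma dense_sequence (S : set X) : S !=set0 -> exists s : nat -> X,
  (forall i, S (s i)) /\
  forall x, S x -> forall r, 0 < r -> exists i, dist x (s i) < r.
Proof.
move=> [x0 Sx0]; have [_ [_ [[D [cD densD]] _]]] := MM.
have [e eP] : exists e : nat -> X, forall x r, 0 < r -> exists i, dist x (e i) < r.
  have /pfcard_geP[D0|[e]] := cD.
    by have [y []] := densD x0 1 ltr01; rewrite D0.
  exists e => x r r0; have [y [Dy xy]] := densD x r r0.
  by have [i _ ey] := @surj _ _ _ _ e y Dy; exists i; rewrite ey.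
pose P i n y := S y /\ dist (e i) y < n.+1%:R^-1.
pose t i n := if pselect (exists y, P i n y) is left h then projT1 (cid h) else x0.
have tS i n : S (t i n).
  by rewrite /t; case: pselect => // h; case: cid => y [].
pose s k := if unpickle k is Some (i, n) then t i n else x0.
exists s; split.
  by move=> k; rewrite /s; case: unpickle => // -[].
move=> x Sx r r0.
have [n] := ltr_add_invr (divr_gt0 r0 (ltr0n R 2)); rewrite add0r => nP.
have n0 : 0 < n.+1%:R^-1 :> R by rewrite invr_gt0.
have [i iP] := eP x _ n0.
exists (pickle (i, n)); rewrite /s pickleK /t; case: pselect => [h|]; last first.
  by case; exists x; split => //; rewrite distC.
case: cid => y [Sy /= ey]; apply: le_lt_trans (dist_tri (e i) x y) _.
by rewrite [r]splitr ltrD// (lt_trans _ nP).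
Qed.

(** A point off the support is the centre of a null ball, which contains a smaller null ball around
    the point from the countable family with centres in a dense sequence and radii [1 / (n + 1)]. *)
Lemma measure_setC_supp (m : {measure set X -> \bar R}) (S : set X) :
  S !=set0 -> dclosed dist S -> supp dist m = S -> m (~` S) = 0%E.
Proof.
move=> [x0 _] cS mS.
have [|e [_ eP]] := @dense_sequence setT; first by exists x0.
have mSC : measurable (~` S) by exact: dopen_measurable.
apply/negligibleP => //.
pose B i n := if m (cball (e i) n.+1%:R^-1) == 0%E then cball (e i) n.+1%:R^-1 else set0.
apply: (@negligibleS _ _ _ _ (\bigcup_i \bigcup_n B i n)); last first.
  apply: negligible_bigcup => i; apply: negligible_bigcup => n.
  rewrite /B; case: ifPn => [/eqP h|_]; last exact: negligible_set0.
  by apply/negligibleP => //; exact: measurable_cball.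
move=> y /= nSy.
have : ~ supp dist m y by rewrite mS.
rewrite /supp/= => /existsNP[r /not_implyP[r0 /negP]].
rewrite -leNgt => mr.
have [n] := ltr_add_invr (divr_gt0 r0 (ltr0n R 2)); rewrite add0r => nP.
have n0 : 0 < n.+1%:R^-1 :> R by rewrite invr_gt0.
have [i iP] := eP y I _ n0.
exists i => //; exists n => //; rewrite /B ifT; first by rewrite /cball/= distC ltW.
rewrite eq_le measure_ge0 andbT; apply: le_trans mr.
apply: le_measure; rewrite ?inE; [exact: measurable_cball..|].
by apply: cball_sub; rewrite [r]splitr lerD// ltW// (lt_trans _ nP).
Qed.

End metric_basics.
Section real_comparison.
Context d (T : measurableType d) (R : realType) (f g : T -> R).
Hypotheses (mf : measurable_fun setT f) (mg : measurable_fun setT g).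

Lemma measurable_set_ltr : measurable [set x | f x < g x].
Proof.
rewrite (_ : [set x | _] = setT `&` [set x | ((EFin \o f) x < (EFin \o g) x)%E]).
  by apply: measurable_lte => //; exact/measurable_EFinP.
by apply/seteqP; split => x /=; rewrite lte_fin// => -[].
Qed.

Lemma measurable_set_ler : measurable [set x | f x <= g x].
Proof.
rewrite (_ : [set x | _] = setT `&` [set x | ((EFin \o f) x <= (EFin \o g) x)%E]).
  by apply: measurable_lee => //; exact/measurable_EFinP.
by apply/seteqP; split => x /=; rewrite lee_fin// => -[].
Qed.

End real_comparison.

(** * Regular sequences force content regularity *)

Section converse.
Context {R : realType} {dsp : measure_display} {X : measurableType dsp}.
Variables (dist : X -> X -> R) (mu : {measure set X -> \bar R}).
Hypothesis MM : metric_measure_space dist mu.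
Local Notation cball := (cball dist).

(* The densities may be negative on a null set, where the hypothesis on the ratio
   says nothing about signs; only [nu2 >= 0] discards that set. *)
Lemma measure_le_of_density_ratio (m0 nu1 nu2 : {measure set X -> \bar R})
    (w1 w2 : X -> R) (c : R) : 0 < c ->
  measurable_fun setT w1 -> measurable_fun setT w2 ->
  (forall A, measurable A -> nu1 A = \int[m0]_(x in A) (w1 x)%:E)%E ->
  (forall A, measurable A -> nu2 A = \int[m0]_(x in A) (w2 x)%:E)%E ->
  {ae m0, forall x, c <= w1 x / w2 x} ->
  forall A, measurable A -> (nu2 A <= (c^-1)%:E * nu1 A)%E.
Proof.
move=> c0 mw1 mw2 nu1E nu2E aew A mA.
pose N := A `&` [set x | w2 x <= 0].
pose P := A `&` [set x | 0 < w2 x].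
pose G := P `&` [set x | w2 x <= c^-1 * w1 x].
pose B := P `&` [set x | c^-1 * w1 x < w2 x].
have mcw1 : measurable_fun setT (fun x => c^-1 * w1 x).
  by apply: measurable_funM => //; exact: measurable_cst.
have mlt : measurable [set x | 0 < w2 x].
  by apply: measurable_set_ltr => //; exact: measurable_cst.
have mle : measurable [set x | w2 x <= 0].
  by apply: measurable_set_ler => //; exact: measurable_cst.
have mN : measurable N by exact: measurableI.
have mP : measurable P by exact: measurableI.
have mG : measurable G.
  by apply: measurableI => //; exact: measurable_set_ler.
have mB : measurable B.
  by apply: measurableI => //; exact: measurable_set_ltr.
(* The integral of a nonpositive function is nonpositive, while a measure is nonnegative. *)
have N0 : nu2 N = 0%E.
  apply/eqP; rewrite eq_le measure_ge0 andbT nu2E// integralE.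
  rewrite (integral0_eq _ (f := (fun x => (w2 x)%:E)^\+)%E); last first.
    by move=> x [_ /= h]; rewrite funeposE; apply/max_idPr; rewrite lee_fin.
  by rewrite sub0e oppe_le0 integral_ge0.
have B0 : nu2 B = 0%E.
  rewrite nu2E// null_set_integral//.
    by apply: measurable_funTS; exact/measurable_EFinP.
  apply/negligibleP => //; apply: negligibleS aew.
  move=> x [[_ /= w20] /= h] H; move: (H); rewrite leNgt => /negP; apply.
  by rewrite ltr_pdivrMr// -ltr_pdivrMl//.
have Aeq : A `<=` G `|` (N `|` B).
  move=> x Ax; have [h|h] := leP (w2 x) 0; first by right; left.
  have [h'|h'] := leP (w2 x) (c^-1 * w1 x); first by left.
  by right; right.
have c'0 : (0 <= (c^-1)%:E :> \bar R)%E by rewrite lee_fin invr_ge0 ltW.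
apply: (@le_trans _ _ (nu2 G)).
  apply: (@le_trans _ _ (nu2 (G `|` (N `|` B)))).
    apply: le_measure; rewrite ?inE//.
    by apply: measurableU => //; exact: measurableU.
  apply: le_trans (measureU2 _ _ _) _ => //; first exact: measurableU.
  rewrite -[leRHS]adde0 leeD2l//.
  by apply: le_trans (measureU2 _ _ _) _ => //; rewrite [X in (X + _)%E]N0 [X in (_ + X)%E]B0 adde0.
apply: (@le_trans _ _ ((c^-1)%:E * nu1 G)%E); last first.
  rewrite lee_pmul2l//; last by rewrite lte_fin invr_gt0.
  by apply: le_measure; rewrite ?inE// => x [[]].
have w10 x : G x -> (0 <= (w1 x)%:E)%E.
  move=> [[_ /= w20] /= h]; rewrite lee_fin.
  by rewrite -(@pmulr_rge0 _ c^-1) ?invr_gt0// (le_trans _ h)// ltW.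
rewrite nu1E// nu2E// -ge0_integralZl_EFin//; last by apply: measurable_funTS; exact/measurable_EFinP.
apply: ge0_le_integral => //.
- by move=> x [[_ /= w20] _]; rewrite lee_fin ltW.
- by apply: measurable_funTS; exact/measurable_EFinP.
- by apply: measurable_funTS; apply/measurable_EFinP.
- by move=> x [_ /= h]; rewrite -EFinM lee_fin.
Qed.

Lemma LCR_of_regular_seq (theta : R) (S : set X) (eps : R)
    (m : nat -> {measure set X -> \bar R}) :
  dclosed dist S -> S !=set0 -> regular_seq dist mu theta S eps m ->
  LCR dist mu theta S.
Proof.
move=> cS S0 [eps01 [_ [M1 [[C1 [C10 M2]] [[C2 [C20 M3]] [w [mw [_ [wE [C3 [C30 M4]]]]]]]]]]].
have e0 : 0 < eps by case/andP: eps01.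
(* (M4) with [j = 1] bounds [w k / w k.+1] from below by [c] almost everywhere on [S]; the
   complement of [S] is null. *)
pose c := eps `^ (theta * 1%:R) / C3.
have c0 : 0 < c by rewrite divr_gt0// powR_gt0.
have mS : measurable S by exact: (dclosed_measurable MM).
have SC0 k : m k (~` S) = 0%E by exact: (measure_setC_supp MM S0 cS (M1 k)).
have step k A : measurable A -> (m k.+1 A <= (c^-1)%:E * m k A)%E.
  apply: (@measure_le_of_density_ratio (m 0%N) _ _ (w k) (w k.+1)) => //; [exact: wE|exact: wE|].
  have : (m 0%N).-negligible (~` S) by apply/negligibleP; [exact: measurableC|exact: SC0].
  move=> SCn; have := M4 k 1%N; rewrite /almost_everywhere => M4n.
  apply: negligibleS (negligibleU M4n SCn) => x /= H.
  have [Sx|nSx] := pselect (S x); last by right.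
  left => /(_ Sx); rewrite addn1 => /andP[h _]; exact: H.
clearbody c; exists (C1^-1 * (c * C2)); split; first by rewrite mulr_gt0 ?invr_gt0// mulr_gt0.
move=> x r Sx r0 r1.
(* At this scale (M2) for [m k] applies to every radius below [r], and (M3) for [m k.+1] applies to
   [r] itself; [step] links the two measures. *)
have [k /andP[kr rk]] := geometric_scale eps01 r0 r1.
apply: le_ereal_inf_tmp => _ [J [ctr [rad [radP [cov ->]]]]].
rewrite EFinM -muleA -lee_pdivlMl ?invr_gt0// invrK.
have mE : measurable (cball x r `&` S).
  by apply: measurableI => //; exact: (measurable_cball MM).
apply: (@le_trans _ _ (m k (cball x r `&` S))); last first.
  apply: (measure_le_esum (F := fun i => cball (ctr i) (rad i))) => //.
  - exact: ltW.
  - by move=> i _; exact: (measurable_cball MM).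
  - by move=> i _; exact: codim_ratio_ge0.
  - move=> i /radP/andP[ri0 rir]; apply: M2 => //.
    exact: le_trans (ltW rir) rk.
have -> : m k (cball x r `&` S) = m k (cball x r).
  apply/eqP; rewrite eq_le; apply/andP; split.
    by apply: le_measure; rewrite ?inE//; exact: (measurable_cball MM).
  apply: (@le_trans _ _ (m k ((cball x r `&` S) `|` ~` S))).
    apply: le_measure; rewrite ?inE; first exact: (measurable_cball MM).
      by apply: measurableU => //; exact: measurableC.
    by move=> y xy; have [Sy|nSy] := pselect (S y); [left|right].
  apply: le_trans (measureU2 _ _ _) _ => //; first exact: measurableC.
  by rewrite [X in (_ + X)%E](SC0 k) adde0.
have mB : measurable (cball x r) by exact: (measurable_cball MM).
rewrite EFinM -muleA -lee_pdivlMl//.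
apply: le_trans (step k _ mB).
by apply: M3 => //; exact: ltW.
Qed.

End converse.
(** * Subadditivity of the content *)

Section content.
Context {R : realType} {dsp : measure_display} {X : measurableType dsp}.
Variables (dist : X -> X -> R) (mu : {measure set X -> \bar R}) (theta delta : R).
Local Notation H := (hcontent dist mu theta delta).
Local Open Scope ereal_scope.

Lemma hcontent_sub (E F : set X) : E `<=` F -> H E <= H F.
Proof.
move=> EF; apply: le_ereal_inf_tmp => s [I [c [rad [radP [cov ->]]]]].
apply: ereal_inf_lbound; exists I, c, rad; split=> //; split=> //.
exact: subset_trans cov.
Qed.

Lemma hcontent_cball (E : set X) x r : (0 < r < delta)%R ->
  E `<=` cball dist x r -> H E <= codim_ratio dist mu theta x r.
Proof.
move=> rd Exr; apply: ereal_inf_lbound.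
exists [set 0%N], (fun=> x), (fun=> r); split=> //; split.
  by move=> y /Exr xy; exists 0%N.
by rewrite esum_set1// codim_ratio_ge0.
Qed.

Lemma hcontent_set0 : H set0 <= 0.
Proof.
apply: ereal_inf_lbound; exists set0, (fun=> point), (fun=> 1%R); split=> //.
by split; [exact: sub0set|rewrite esum_set0].
Qed.

Lemma hcontentU (E F : set X) (a b : R) : H E <= a%:E -> H F <= b%:E ->
  H (E `|` F) <= (a + b)%:E.
Proof.
move=> HE HF; apply/lee_addgt0Pr => e e0.
have e20 : (0 < e / 2)%R by rewrite divr_gt0.
have cover G (z : R) : H G <= z%:E -> exists (I : set nat) (c : nat -> X) (rad : nat -> R),
   [/\ forall i, I i -> (0 < rad i < delta)%R,
       G `<=` \bigcup_(i in I) cball dist (c i) (rad i) &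
       \esum_(i in I) codim_ratio dist mu theta (c i) (rad i) <= (z + e / 2)%:E].
  move=> HG; have : H G < (z + e / 2)%:E.
    by apply: le_lt_trans HG _; rewrite lte_fin ltrDl.
  move=> /ereal_inf_lt[_ [I [c [rad [h1 [h2 ->]]]]] /ltW h3].
  by exists I, c, rad.
have [I1 [c1 [rad1 [h1 cov1 s1]]]] := cover E a HE.
have [I2 [c2 [rad2 [h2 cov2 s2]]]] := cover F b HF.
(* The two coverings are interleaved: the first on even indices, the second on odd ones. *)
pose I := [set n | if odd n then I2 n./2 else I1 n./2].
pose c n := if odd n then c2 n./2 else c1 n./2.
pose rad n := if odd n then rad2 n./2 else rad1 n./2.
apply: (@le_trans _ _ (\esum_(i in I) codim_ratio dist mu theta (c i) (rad i))).
  apply: ereal_inf_lbound; exists I, c, rad; split; last split=> //.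
    by move=> i; rewrite /I /rad/=; case: ifP => _; [move=> /h2|move=> /h1].
  move=> x [/cov1[i Ii xi]|/cov2[i Ii xi]].
    exists i.*2; first by rewrite /I/= odd_double doubleK.
    by rewrite /c /rad odd_double doubleK.
  exists i.*2.+1; first by rewrite /I/= odd_double/= uphalf_double.
  by rewrite /c /rad/= odd_double/= uphalf_double.
have esplit : \esum_(i in I) codim_ratio dist mu theta (c i) (rad i) =
   \esum_(i in I1) codim_ratio dist mu theta (c1 i) (rad1 i) +
   \esum_(i in I2) codim_ratio dist mu theta (c2 i) (rad2 i).
  rewrite (esumID [set n | odd n]); last by move=> i _; exact: codim_ratio_ge0.
  rewrite addeC; congr (_ + _).
    rewrite (_ : I `&` ~` [set n | odd n] = (fun i => i.*2) @` I1).
      rewrite esum_image; last by move=> i j _ _; exact: double_inj.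
      by apply: eq_esum => i _; rewrite /c /rad odd_double doubleK.
    apply/seteqP; split => n.
      move=> [+ /= /negP/negbTE on]; rewrite /I/= on => In; exists n./2 => //.
      by have := odd_double_half n; rewrite on add0n.
    by move=> [i Ii <-]; split; rewrite /I/= odd_double ?doubleK.
  rewrite (_ : I `&` [set n | odd n] = (fun i => i.*2.+1) @` I2).
    rewrite esum_image; last by move=> i j _ _ [] /double_inj.
    by apply: eq_esum => i _; rewrite /c /rad/= odd_double/= uphalf_double.
  apply/seteqP; split => n.
    move=> [+ /= on]; rewrite /I/= on => In; exists n./2 => //.
    by have := odd_double_half n; rewrite on add1n.
  by move=> [i Ii <-]; split; rewrite /I/= odd_double//= uphalf_double.
rewrite esplit (splitr e) -EFinD addrACA EFinD; exact: leeD.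
Qed.

Lemma hcontent_sum (n : nat) (P : pred nat) (E : nat -> set X) (a : nat -> R) :
  (forall i, P i -> H (E i) <= (a i)%:E) ->
  H (\bigcup_(i in [set i | (i < n)%N && P i]) E i) <= (\sum_(i < n | P i) a i)%:E.
Proof.
move=> Ea; elim: n => [|n IH].
  rewrite big_ord0 bigcup0 ?hcontent_set0//.
rewrite [X in H X](_ : _ = (\bigcup_(i in [set i | (i < n)%N && P i]) E i) `|`
    (if P n then E n else set0)); last first.
  apply/seteqP; split => x.
    move=> [i /= /andP[+ Pi] Ei]; rewrite ltnS leq_eqVlt => /orP[/eqP ni|lin].
      by right; rewrite -ni Pi.
    by left; exists i => //=; rewrite lin.
  move=> [[i /= /andP[lin Pi] Ei]|].
    by exists i => //=; rewrite Pi (ltn_trans lin).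
  by case: ifPn => // Pn En; exists n => //=; rewrite ltnSn Pn.
rewrite big_mkcond big_ord_recr/= -big_mkcond/=.
apply: hcontentU => //; case: ifPn => [/Ea//|_].
exact: hcontent_set0.
Qed.

End content.
Lemma sum_measure_le d (T : measurableType d) (R : realType)
    (m : {measure set T -> \bar R}) (F : nat -> set T) (G : set T) (P : pred nat) n :
  (forall i, P i -> measurable (F i)) -> measurable G ->
  (forall i j, P i -> P j -> i != j -> F i `&` F j = set0) ->
  (forall i, P i -> F i `<=` G) ->
  (\sum_(i < n | P i) m (F i) <= m G)%E.
Proof.
move=> mF mG dF FG.
pose U n := \bigcup_(i in [set i | (i < n)%N && P i]) F i.
have mU k : measurable (U k).
  by apply: bigcup_measurable => i /= /andP[_]; exact: mF.
have -> : (\sum_(i < n | P i) m (F i) = m (U n))%E.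
  elim: n => [|n IH].
    rewrite big_ord0 (_ : U 0%N = set0) ?measure0//.
    by apply/seteqP; split => x // [i].
  rewrite big_mkcond big_ord_recr/= -big_mkcond/= IH.
  have [Pn|nPn] := boolP (P n); last first.
    rewrite adde0; congr (m _); apply/seteqP; split => x [i /= /andP[lin Pi] Fi].
      by exists i => //=; rewrite Pi ltnS ltnW.
    exists i => //=; rewrite Pi andbT ltn_neqAle -ltnS lin andbT.
    by apply/eqP => ni; move: nPn; rewrite -ni Pi.
  rewrite -measureU//; last first.
  - apply/seteqP; split => x // [[i /= /andP[lin Pi] Fi] Fn].
    have : (F i `&` F n) x by split.
    by rewrite dF// neq_ltn lin.
  - exact: mF.
  congr (m _); apply/seteqP; split => x.
    move=> [[i /= /andP[lin Pi] Fi]|Fn].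
      by exists i => //=; rewrite Pi ltnS ltnW.
    by exists n => //=; rewrite Pn ltnSn.
  move=> [i /= /andP[+ Pi] Fi]; rewrite ltnS leq_eqVlt => /orP[/eqP ni|lin].
    by right; rewrite -ni.
  by left; exists i => //=; rewrite lin.
apply: le_measure; rewrite ?inE// => x [i /= /andP[_ Pi]].
exact: FG.
Qed.

(** * The forest of nets and its cells *)

Section net_tree.
Context {R : realType} {dsp : measure_display} {X : measurableType dsp}.
Variables (dist : X -> X -> R) (s : nat -> X).

(* Any ratio with [4 * eps < 1 / 8] would do. *)
Definition eps : R := 40%:R^-1.

(** A greedy scan of the enumeration yields a maximal [eps ^+ k]-separated set without choice;
    working on prefixes keeps it a finite list. *)
Fixpoint net k n : seq nat :=
  if n is n'.+1 then
    if all (fun j => eps ^+ k <= dist (s j) (s n')) (net k n') then rcons (net k n') n'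
    else net k n'
  else [::].

Definition node k i : bool := all (fun j => eps ^+ k <= dist (s j) (s i)) (net k i).

(* The last clause makes a node adopt every node of the next level that is well
   inside its reach; this is what keeps the cells disjoint. *)
Definition par k b : nat := xget 0%N [set a | [/\ node k a, dist (s a) (s b) < eps ^+ k &
  forall a', node k a' -> dist (s a') (s b) < eps ^+ k / 2 -> a' = a]].

Definition child k a b : bool := node k.+1 b && (par k b == a).

Fixpoint cellN n k a : set X :=
  if n is n'.+1 then \bigcup_(b in [set b | child k a b]) cellN n' k.+1 b
  else cball dist (s a) (eps ^+ k / 8).

Definition cell k a : set X := \bigcup_n cellN n k a.

(* A bound for the children of [a]; by doubling it exists ([nchildP]). *)
Definition nchild k a : nat := xget 0%N [set M | forall b, child k a b -> (b < M)%N].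

Variable (mu : {measure set X -> \bar R}).
Hypothesis MM : metric_measure_space dist mu.
Local Notation cball := (cball dist).
Local Notation vol := (vol dist mu).

Lemma eps_gt0 : 0 < eps.
Proof. by rewrite /eps invr_gt0. Qed.

Lemma epsX_gt0 k : 0 < eps ^+ k.
Proof. by rewrite exprn_gt0// eps_gt0. Qed.

Lemma epsS k : eps ^+ k.+1 = eps ^+ k / 40.
Proof. by rewrite exprSr. Qed.

Lemma eps_lt1 : eps < 1.
Proof. by rewrite /eps invf_lt1// ltr1n. Qed.

Lemma epsX_le1 k : eps ^+ k <= 1.
Proof. by apply: exprn_ile1; [exact: ltW eps_gt0|exact: ltW eps_lt1]. Qed.

Lemma mem_net k n i : (i \in net k n) = (i < n)%N && node k i.
Proof.
elim: n => [|n IH] //=.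
rewrite -/(node k n); case: ifPn => nn.
  rewrite mem_rcons inE IH ltnS [in RHS]leq_eqVlt.
  by case: eqVneq => [->|] //=; rewrite nn.
rewrite IH ltnS [in RHS]leq_eqVlt; case: eqVneq => [->|]//=.
by rewrite ltnn (negbTE nn).
Qed.

Lemma node_sep k a b : node k a -> node k b -> a != b -> eps ^+ k <= dist (s a) (s b).
Proof.
wlog ab : a b / (a < b)%N => [H|] na nb.
  rewrite neq_ltn => /orP[ab|ba]; first by apply: H => //; rewrite ltn_eqF.
  by rewrite (distC MM); apply: H => //; rewrite ltn_eqF.
by move=> _; move/allP: nb; apply; rewrite mem_net ab.
Qed.

Lemma node_max k i : exists a, node k a /\ dist (s a) (s i) < eps ^+ k.
Proof.
have [ni|] := boolP (node k i).
  by exists i; split => //; rewrite (distxx MM) epsX_gt0.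
move=> /allPn[a]; rewrite mem_net => /andP[_ na]; rewrite -ltNge => h.
by exists a.
Qed.

(** By separation at most one node lies within [eps ^+ k / 2] of [s b]. It is the parent if it
    exists; otherwise maximality of the net supplies a node within [eps ^+ k], and the last clause
    is vacuous. *)
Lemma parP k b : [/\ node k (par k b), dist (s (par k b)) (s b) < eps ^+ k &
  forall a', node k a' -> dist (s a') (s b) < eps ^+ k / 2 -> a' = par k b].
Proof.
rewrite /par; case: xgetP => [a _ //|H].
have e0 := epsX_gt0 k.
have uniq a a' : node k a -> node k a' -> dist (s a) (s b) < eps ^+ k / 2 ->
    dist (s a') (s b) < eps ^+ k / 2 -> a' = a.
  move=> na na' h h'; apply/eqP; apply: contraT => aa'.
  have := node_sep na' na aa'; have := dist_tri MM (s b) (s a') (s a).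
  by rewrite (distC MM (s b)); lra.
have [[a [na h]]|nex] := pselect (exists a, node k a /\ dist (s a) (s b) < eps ^+ k / 2).
  exfalso; apply: (H a); split => //; first by lra.
  by move=> a' na' h'; exact: (uniq a a').
have [a [na h]] := node_max k b.
exfalso; apply: (H a); split => // a' na' h'.
by exfalso; apply: nex; exists a'.
Qed.

Lemma par_node k b : node k (par k b).
Proof. by have [] := parP k b. Qed.

Lemma child_par k b : node k.+1 b -> child k (par k b) b.
Proof. by rewrite /child eqxx andbT. Qed.

Lemma child_node k a b : child k a b -> node k.+1 b.
Proof. by case/andP. Qed.

Lemma child_dist k a b : child k a b -> dist (s a) (s b) < eps ^+ k.
Proof. by move=> /andP[_ /eqP <-]; have [] := parP k b. Qed.

Lemma near_child k a b : node k a -> node k.+1 b -> dist (s a) (s b) < eps ^+ k / 2 ->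
  child k a b.
Proof. by move=> na nb h; rewrite /child nb; have [_ _ /(_ a na h) ->] := parP k b; rewrite eqxx. Qed.

Lemma cellN_sub n k a : cellN n k a `<=` cball (s a) (2 * eps ^+ k).
Proof.
elim: n k a => [|n IH] k a x /=; have e0 := epsX_gt0 k.
  by rewrite /Defs.cball/=; lra.
move=> [b /= /child_dist ab /IH]; rewrite /Defs.cball/= epsS.
(* The step to a child costs [eps ^+ k], and everything below it [2 * eps ^+ k.+1], which is
   [eps ^+ k / 20]. *)
by have := dist_tri MM (s b) (s a) x; lra.
Qed.

Lemma cell_sub k a : cell k a `<=` cball (s a) (2 * eps ^+ k).
Proof. by move=> x [n _ /cellN_sub]. Qed.

Lemma sub_cell k a : cball (s a) (eps ^+ k / 8) `<=` cell k a.
Proof. by move=> x h; exists 0%N. Qed.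

Lemma cell_child k a b : child k a b -> cell k.+1 b `<=` cell k a.
Proof. by move=> ab x [n _ h]; exists n.+1 => //; exists b. Qed.

Lemma measurable_cell k a : measurable (cell k a).
Proof.
apply: bigcup_measurable => n _; elim: n k a => [|n IH] k a.
  exact: (measurable_cball MM).
exact: bigcup_measurable.
Qed.

(** Two small balls are apart by separation. If the ball of [b] meets a deeper part of [b'], the
    child [c] of [b'] involved is within [eps ^+ k / 8 + 2 * eps ^+ k.+1] of [s b], less than
    [eps ^+ k / 2], so [c] is a child of [b] as well and [b = b']. If both parts are deeper,
    induction applies to children, which differ because their parents do. *)
Lemma cellN_disj n n' k a a' x : node k a -> node k a' -> a != a' ->
  cellN n k a x -> cellN n' k a' x -> False.
Proof.
have H0 k0 b b' m y : node k0 b -> node k0 b' -> b != b' ->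
    cellN 0 k0 b y -> cellN m.+1 k0 b' y -> False.
  move=> nb nb' bb' /= yb [c /= cc /cellN_sub]; rewrite /Defs.cball/= epsS => cy.
  have : child k0 b c.
    apply: near_child => //; first exact: child_node cc.
    have := dist_tri MM y (s b) (s c); rewrite (distC MM y).
    by move: yb; rewrite /Defs.cball/=; have := epsX_gt0 k0; lra.
  by move: cc bb' => /andP[_ /eqP cb'] + /andP[_ /eqP cb]; rewrite -cb -cb' eqxx.
elim: n n' k a a' => [|n IH] [|n'] k a a' na na' aa'.
- rewrite /= /Defs.cball/= => xa xa'; have := node_sep na na' aa'.
  have := dist_tri MM x (s a) (s a'); rewrite (distC MM x).
  by have := epsX_gt0 k; lra.
- exact: H0.
- by move=> h h'; apply: (H0 _ _ _ _ _ na' na _ h' h); rewrite eq_sym.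
- move=> [b /= ab xb] [b' /= ab' xb']; apply: (IH n' k.+1 b b') => //.
  + exact: child_node ab.
  + exact: child_node ab'.
  + apply: contra aa' => /eqP bb'; move: ab ab'; rewrite bb'.
    by move=> /andP[_ /eqP <-] /andP[_ /eqP <-].
Qed.

Lemma cell_disj k a a' : node k a -> node k a' -> a != a' -> cell k a `&` cell k a' = set0.
Proof.
move=> na na' aa'; apply/seteqP; split => x // [[n _ h] [n' _ h']].
by exfalso; exact: (cellN_disj na na' aa' h h').
Qed.

Hypothesis DB : unif_loc_doubling dist mu.

(** The cells of the children are disjoint, lie in one ball around [s a], and by doubling each takes
    a fixed fraction of its measure. Children of unbounded index would be infinitely many. *)
Lemma nchildP k a b : child k a b -> (b < nchild k a)%N.
Proof.
rewrite /nchild; case: xgetP => [M _ MP|H]; first exact: MP.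
exfalso.
have unb M : exists b, child k a b /\ (M <= b)%N.
  apply: contrapT => nex; apply: (H M) => c cc; rewrite ltnNge; apply/negP => Mc.
  by apply: nex; exists c.
(* The factor 1000 turns the radius [eps ^+ k.+1 / 8] into more than [3 * eps ^+ k], enough to
   contain the ball of radius [2 * eps ^+ k] around the parent. *)
have [C [C0 CP]] := vol_doubling MM 1000%:R DB ltr01.
have e0 := epsX_gt0 k.
pose dl := vol (s a) (2 * eps ^+ k) / C.
have dl0 : 0 < dl by rewrite divr_gt0// (vol_gt0 MM)//; lra.
have big c : child k a c -> dl <= vol (s c) (eps ^+ k.+1 / 8).
  move=> ac; rewrite ler_pdivrMr// [leRHS]mulrC; apply: CP; rewrite ?epsS.
  - lra.
  - by have := epsX_le1 k; lra.
  - lra.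
  - by rewrite (distC MM); have := child_dist ac; lra.
pose cnt n : R := \sum_(i < n | child k a i) 1.
have cntP n : cnt n * dl <= vol (s a) (2 * eps ^+ k).
  rewrite /cnt mulr_suml -lee_fin -sumEFin -(volE MM); last lra.
  apply: le_trans (@sum_measure_le _ _ _ mu (cell k.+1) _ (child k a) n _ _ _ _).
  - apply: lee_sum => i ac; rewrite mul1r.
    apply: (@le_trans _ _ (vol (s i) (eps ^+ k.+1 / 8))%:E).
      by rewrite lee_fin big.
    rewrite -(volE MM); last by rewrite epsS; lra.
    apply: le_measure; rewrite ?inE; [exact: (measurable_cball MM)|exact: measurable_cell|].
    exact: sub_cell.
  - by move=> i _; exact: measurable_cell.
  - exact: (measurable_cball MM).
  - by move=> i j ai aj ij; apply: cell_disj => //; [exact: child_node ai|exact: child_node aj].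
  - by move=> i ai; apply: subset_trans (cell_child ai) (@cell_sub _ _).
have cntS n m : (n <= m)%N -> cnt n <= cnt m.
  elim: m => [|m IH]; first by rewrite leqn0 => /eqP ->.
  rewrite leq_eqVlt => /orP[/eqP ->//|]; rewrite ltnS => /IH /le_trans; apply.
  rewrite /cnt [leRHS]big_mkcond big_ord_recr/= -big_mkcond/= lerDl.
  by case: ifP.
have cntbig K : exists n, K%:R <= cnt n.
  elim: K => [|K [n IH]]; first by exists 0%N; rewrite /cnt big_ord0.
  have [c [ac nc]] := unb n; exists c.+1.
  rewrite /cnt big_mkcond big_ord_recr/= -big_mkcond/= ac -natr1 lerD2r.
  by apply: le_trans IH _; exact: cntS.
have [n] := cntbig (Num.bound C).
have := archi_boundP (ltW C0); have := cntP n.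
have dlC : vol (s a) (2 * eps ^+ k) = C * dl by rewrite /dl mulrCA mulfV ?mulr1// gt_eqF.
rewrite {1}dlC ler_pM2r//; lra.
Qed.

(** * Cell weights and minimal cuts *)

Variables (theta : R) (S : set X).
Hypothesis theta0 : 0 <= theta.

Definition ratio_q : R := eps `^ theta.
Local Notation q := ratio_q.

Lemma ratio_q_gt0 : 0 < q.
Proof. exact: powR_gt0 eps_gt0. Qed.

Lemma ratio_q_le1 : q <= 1.
Proof.
rewrite -(powRr0 eps); apply: ger_powR => //.
by rewrite eps_gt0 ltW// eps_lt1.
Qed.

Lemma qX_gt0 k : 0 < q ^+ k.
Proof. by rewrite exprn_gt0// ratio_q_gt0. Qed.

Lemma epsX_powR k : (eps ^+ k) `^ theta = q ^+ k.
Proof.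
by rewrite -powR_mulrn ?(ltW eps_gt0)// -powRrM mulrC powRrM powR_mulrn// powR_ge0.
Qed.

Definition weight k a : R := fine (mu (cell k a)) / q ^+ k.

Lemma mu_cell k a : mu (cell k a) = (weight k a * q ^+ k)%:E.
Proof.
rewrite /weight divfK ?gt_eqF ?qX_gt0// fineK// ge0_fin_numE//.
have e0 := epsX_gt0 k.
have h : 0 < 2 * eps ^+ k by lra.
apply: le_lt_trans (cball_lty MM (s a) h).
by apply: le_measure; rewrite ?inE; [exact: measurable_cell|exact: (measurable_cball MM)|exact: cell_sub].
Qed.

Lemma weight_lower k a : vol (s a) (eps ^+ k / 8) <= weight k a * q ^+ k.
Proof.
have e0 := epsX_gt0 k.
rewrite -lee_fin -mu_cell -(volE MM); last lra.
by apply: le_measure; rewrite ?inE; [exact: (measurable_cball MM)|exact: measurable_cell|exact: sub_cell].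
Qed.

Lemma weight_upper k a : weight k a * q ^+ k <= vol (s a) (2 * eps ^+ k).
Proof.
have e0 := epsX_gt0 k.
rewrite -lee_fin -mu_cell -(volE MM); last lra.
by apply: le_measure; rewrite ?inE; [exact: measurable_cell|exact: (measurable_cball MM)|exact: cell_sub].
Qed.

Lemma weight_gt0 k a : 0 < weight k a.
Proof.
rewrite -(pmulr_lgt0 _ (qX_gt0 k)); apply: lt_le_trans (weight_lower k a).
by apply: (vol_gt0 MM); have := epsX_gt0 k; lra.
Qed.

Lemma sum_weight k a : \sum_(b < nchild k a | child k a b) weight k.+1 b <= weight k a / q.
Proof.
have q0 := ratio_q_gt0; have qk0 := qX_gt0 k.+1.
rewrite ler_pdivlMr// -(ler_pM2r (qX_gt0 k)) -mulrA -exprS mulr_suml.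
rewrite -lee_fin -sumEFin -mu_cell.
rewrite (eq_bigr (fun b : 'I__ => mu (cell k.+1 b))); last by move=> b _; rewrite mu_cell.
apply: (@sum_measure_le _ _ _ mu (cell k.+1) _ (child k a)).
- by move=> i _; exact: measurable_cell.
- exact: measurable_cell.
- by move=> i j ai aj ij; apply: cell_disj => //; [exact: child_node ai|exact: child_node aj].
- by move=> i; exact: cell_child.
Qed.

(* The least [weight] of a cut of depth at most [n] below [a]. *)
Fixpoint cutN n k a : R :=
  if n is n'.+1 then
    Num.min (weight k a) (\sum_(b < nchild k a | child k a b) cutN n' k.+1 b)
  else weight k a.

Definition cut k a : R := limn (fun n => cutN n k a).

Lemma cutN_ge0 n k a : 0 <= cutN n k a.
Proof.
elim: n k a => [|n IH] k a /=; first exact: ltW (weight_gt0 _ _).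
by rewrite le_min (ltW (weight_gt0 _ _))/= sumr_ge0.
Qed.

Lemma cutN_decr k a : nonincreasing_seq (fun n => cutN n k a).
Proof.
apply/nonincreasing_seqP => n; elim: n k a => [|n IH] k a.
  by rewrite /= ge_min lexx.
rewrite [leLHS]/= [leRHS]/= le_min ge_min lexx/= ge_min; apply/orP; right.
by apply: ler_sum => b _; exact: IH.
Qed.

Lemma cutN_cvg k a : cvgn (fun n => cutN n k a).
Proof.
apply: nonincreasing_is_cvgn; first exact: cutN_decr.
by exists 0 => _ [n _ <-]; exact: cutN_ge0.
Qed.

Lemma cut_le_cutN n k a : cut k a <= cutN n k a.
Proof. exact: nonincreasing_cvgn_ge (@cutN_decr k a) (@cutN_cvg k a) n. Qed.

Lemma cut_le_weight k a : cut k a <= weight k a.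
Proof. exact: cut_le_cutN 0%N k a. Qed.

Lemma cut_le_sum k a : cut k a <= \sum_(b < nchild k a | child k a b) cut k.+1 b.
Proof.
(* The children are finitely many, so the limit in [n] passes through the sum. *)
have cv : (fun n => \sum_(b < nchild k a | child k a b) cutN n k.+1 b) @ \oo -->
    \sum_(b < nchild k a | child k a b) cut k.+1 b.
  apply: (@cvg_big _ _ +%R) => //; first exact: add_continuous.
  by move=> b _; exact: cutN_cvg.
rewrite -(cvg_lim _ cv)//; apply: limr_ge; first by apply/cvg_ex; eexists; exact: cv.
apply: nearW => n; apply: le_trans (cut_le_cutN n.+1 k a) _.
by rewrite /= ge_min lexx orbT.
Qed.

(** The minimum of the weight and of the sum over the children is at most the cut. If the minimum is
    the weight, [sum_weight] loses only the factor [1 / q]; if it is the sum, [q <= 1] suffices. *)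
Lemma sum_cut_le k a : 0 <= cut k a ->
  \sum_(b < nchild k a | child k a b) cut k.+1 b <= cut k a / q.
Proof.
move=> c0; have q0 := ratio_q_gt0; have q1 := ratio_q_le1.
set C := (leLHS).
have minC : Num.min (weight k a) C <= cut k a.
  apply: limr_ge; first exact: cutN_cvg.
  apply: nearW => -[|n] /=; first by rewrite ge_min lexx.
  rewrite le_min ge_min lexx/= ge_min; apply/orP; right.
  by apply: ler_sum => b _; exact: cut_le_cutN.
rewrite ler_pdivlMr//.
have Ch : C <= weight k a / q.
  by apply: le_trans (sum_weight k a); apply: ler_sum => b _; exact: cut_le_weight.
have [C0|C0] := leP C 0.
  by apply: le_trans c0; rewrite mulr_le0_ge0// ltW.
move: minC; rewrite ge_min => /orP[h|h].
  by apply: le_trans h; rewrite -ler_pdivlMr.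
by apply: le_trans h; rewrite ger_pMr.
Qed.

(** * Cuts as coverings: comparison with the Hausdorff content *)

Fixpoint coverN n k a : set X :=
  if n is n'.+1 then \bigcup_(b in [set b | child k a b]) coverN n' k.+1 b
  else cball (s a) (2 * eps ^+ k).

Lemma coverN_sub n k a : coverN n k a `<=` cball (s a) (4 * eps ^+ k).
Proof.
elim: n k a => [|n IH] k a x /=; have e0 := epsX_gt0 k.
  by rewrite /Defs.cball/=; lra.
move=> [b /= /child_dist ab /IH]; rewrite /Defs.cball/= epsS.
by have := dist_tri MM (s b) (s a) x; lra.
Qed.

Hypothesis s_dense : forall x, S x -> forall r, 0 < r -> exists i, dist x (s i) < r.

(** One [eps ^+ k] leads to a point of the sequence and another to a node. Hence the radius
    [2 * eps ^+ k] in [coverN], whose balls have to cover [S], while the small balls in [cellN]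
    serve disjointness. *)
Lemma node_dense k x : S x -> exists a, node k a /\ dist (s a) x <= 2 * eps ^+ k.
Proof.
move=> Sx; have e0 := epsX_gt0 k.
have [i xi] := s_dense Sx e0; have [a [na ai]] := node_max k i.
exists a; split=> //; have := dist_tri MM (s i) (s a) x.
by rewrite (distC MM (s i) x); lra.
Qed.

Lemma coverN_cover n k x : S x -> exists a, node k a /\ coverN n k a x.
Proof.
elim: n k => [|n IH] k Sx.
  exact: node_dense.
have [b [nb xb]] := IH k.+1 Sx.
exists (par k b); split; first exact: par_node.
by exists b => //; exact: child_par.
Qed.

(** A covering leaf found below some [b] of the next level is within [4 * eps ^+ k.+1], that is
    [eps ^+ k / 10], of [s b]. Then [s b] is well inside the reach of [s a], so [b] is a child of
    [a] and no other part of the forest is involved. *)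
Lemma coverN_near n k a x : S x -> node k a -> dist (s a) x <= eps ^+ k / 8 ->
  coverN n.+1 k a x.
Proof.
move=> Sx na ax; have [b [nb xb]] := coverN_cover n k.+1 Sx.
exists b => //; apply: near_child => //.
move: (coverN_sub xb); rewrite /Defs.cball/= epsS.
have := dist_tri MM x (s a) (s b); rewrite (distC MM x (s b)).
by have := epsX_gt0 k; lra.
Qed.

Lemma codim_ratio_weight : exists K : R, 0 < K /\ forall k a,
  (codim_ratio dist mu theta (s a) (4 * eps ^+ k) <= (K * weight k a)%:E)%E.
Proof.
(* 32 is the ratio of [4 * eps ^+ k] to the radius [eps ^+ k / 8] of the ball inside the cell. *)
have [C [C0 CP]] := vol_doubling MM 32 DB ltr01.
exists C; split=> // k a; have e0 := epsX_gt0 k; have e1 := epsX_le1 k.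
have qk := qX_gt0 k.
have e4 : 0 < 4 * eps ^+ k by lra.
rewrite (codim_ratioE MM)// lee_fin ler_pdivrMr ?powR_gt0//.
apply: (@le_trans _ _ (C * weight k a * q ^+ k)); last first.
  apply: ler_wpM2l; first by rewrite mulr_ge0 ?ltW// weight_gt0.
  rewrite -epsX_powR; apply: ge0_ler_powR => //; rewrite ?nnegrE; lra.
rewrite -mulrA; apply: le_trans (ler_wpM2l (ltW C0) (weight_lower k a)).
by apply: CP; rewrite ?(distxx MM); lra.
Qed.

(** The minimum in [cutN] chooses a covering: where the weight is smaller, a single ball of radius
    [4 * eps ^+ k] replaces all leaves below [a]; where the sum is smaller, subadditivity passes to
    the children. *)
Lemma hcontent_coverN (K delta : R) : 0 < K ->
  (forall k a, codim_ratio dist mu theta (s a) (4 * eps ^+ k) <= (K * weight k a)%:E)%E ->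
  forall n k a, 4 * eps ^+ k < delta ->
  (hcontent dist mu theta delta (coverN n k a) <= (K * cutN n k a)%:E)%E.
Proof.
move=> K0 KP.
have base n k a : 4 * eps ^+ k < delta ->
    (hcontent dist mu theta delta (coverN n k a) <= (K * weight k a)%:E)%E.
  move=> kd; apply: le_trans (KP k a); apply: hcontent_cball.
    by rewrite kd andbT; have := epsX_gt0 k; lra.
  exact: coverN_sub.
elim=> [|n IH] k a kd; first exact: base.
have kd' : 4 * eps ^+ k.+1 < delta by rewrite epsS; have := epsX_gt0 k; lra.
rewrite [cutN _ _ _]/=; case: (leP (weight k a)) => _; first exact: base.
rewrite mulr_sumr.
have {}IH b : child k a b -> (hcontent dist mu theta delta (coverN n k.+1 b) <= (K * cutN n k.+1 b)%:E)%E.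
  by move=> _; exact: IH.
apply: le_trans (hcontent_sum (nchild k a) IH); apply: hcontent_sub.
by move=> x [b /= ab xb]; exists b => //=; rewrite ab andbT nchildP.
Qed.

Hypothesis sS : forall i, S (s i).

(** Near [s a] the set [S] is covered by the leaves below the children of [a], so its content there
    is at most a multiple of the sum of their cuts; content regularity bounds it below by a multiple
    of the weight. *)
Lemma weight_le_cut : LCR dist mu theta S ->
  exists kappa : R, 0 < kappa /\ forall k a, node k a -> kappa * weight k a <= cut k a.
Proof.
move=> [lam [lam0 lamP]].
have [K [K0 KP]] := codim_ratio_weight.
have [C [C0 CP]] := vol_doubling MM 16 DB ltr01.
(* The entry 1 serves the cut that consists of [a] alone, the other entry the cuts through its
   children. *)
pose kappa := Num.min 1 (lam / (C * K)).
have kap1 : kappa <= 1 by rewrite /kappa ge_min lexx.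
have kap2 : kappa <= lam / (C * K) by rewrite /kappa ge_min lexx orbT.
exists kappa; split; first by rewrite /kappa lt_min ltr01 divr_gt0// mulr_gt0.
move=> k a na; apply: limr_ge; first exact: cutN_cvg.
have w0 := weight_gt0 k a.
apply: nearW => -[|n]; first by rewrite /= ger_pMl.
rewrite [leRHS]/= le_min ger_pMl// kap1/=.
have e0 := epsX_gt0 k; have e1 := epsX_le1 k; have qk := qX_gt0 k.
pose r := eps ^+ k / 8.
have r0 : 0 < r by rewrite /r; lra.
have r1 : r <= 1 by rewrite /r; lra.
have := lamP (s a) r (sS a) r0 r1.
(* The content at scale [r] admits only radii below [r]; this is where [4 * eps < 1 / 8] enters. *)
have dlt : 4 * eps ^+ k.+1 < r by rewrite epsS /r; lra.
have IH b : child k a b -> (hcontent dist mu theta r (coverN n k.+1 b) <= (K * cutN n k.+1 b)%:E)%E.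
  by move=> _; exact: hcontent_coverN.
have sub : cball (s a) r `&` S `<=` \bigcup_(b in [set b | (b < nchild k a)%N && child k a b]) coverN n k.+1 b.
  move=> x [xa Sx]; have [b ab xb] := coverN_near n Sx na xa.
  by exists b => //=; rewrite nchildP//; exact: ab.
move=> /le_trans/(_ (hcontent_sub _ _ _ _ sub)).
move=> /le_trans/(_ (hcontent_sum (nchild k a) IH)).
rewrite (codim_ratioE MM)// -EFinM lee_fin -mulr_sumr.
set Sg := \sum_(_ < _ | _) _ => H.
have volC : weight k a * q ^+ k <= C * vol (s a) r.
  apply: le_trans (weight_upper k a) _; apply: CP; rewrite ?(distxx MM) /r; lra.
have rq : r `^ theta <= q ^+ k.
  by rewrite -epsX_powR; apply: ge0_ler_powR => //; rewrite ?nnegrE /r; lra.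
have rt0 : 0 < r `^ theta by rewrite powR_gt0.
have v0 : 0 < vol (s a) r by exact: (vol_gt0 MM).
have {}H : lam * (vol (s a) r / q ^+ k) <= K * Sg.
  apply: le_trans H; rewrite ler_pM2l// ler_pM2l// lef_pV2 ?posrE//.
apply: (@le_trans _ _ (lam / (C * K) * weight k a)).
  by rewrite ler_pM2r.
rewrite -(ler_pM2l K0); apply: le_trans H.
have -> : K * (lam / (C * K) * weight k a) = lam * (C^-1 * weight k a).
  by field; rewrite !gt_eqF.
rewrite ler_pM2l// ler_pdivrMl// mulrA ler_pdivlMr//.
Qed.

End net_tree.

(** * Prefix sums and consecutive intervals *)

Section prefix_sums.
Context {R : realType} (P : pred nat) (f : nat -> R).
Hypothesis f0 : forall i, P i -> 0 <= f i.
Definition prefix_sum n : R := \sum_(i < n | P i) f i.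

Lemma prefix_sumS n : P n -> prefix_sum n.+1 = prefix_sum n + f n.
Proof. by move=> Pn; rewrite /prefix_sum big_mkcond big_ord_recr/= -big_mkcond/= Pn. Qed.

Lemma prefix_sum_mono m n : (m <= n)%N -> prefix_sum m <= prefix_sum n.
Proof.
elim: n => [|n IH]; first by rewrite leqn0 => /eqP ->.
rewrite leq_eqVlt => /orP[/eqP ->//|]; rewrite ltnS => /IH /le_trans; apply.
rewrite /prefix_sum [leRHS]big_mkcond big_ord_recr/= -big_mkcond/= lerDl.
by case: ifP => // /f0.
Qed.

Lemma prefix_sum_ge0 n : 0 <= prefix_sum n.
Proof. by rewrite /prefix_sum sumr_ge0// => i /f0. Qed.

Lemma prefix_sum_le i n : P i -> (i < n)%N -> prefix_sum i + f i <= prefix_sum n.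
Proof. by move=> Pi lin; rewrite -prefix_sumS//; exact: prefix_sum_mono. Qed.

Lemma prefix_sum_split n t : 0 <= t -> t < prefix_sum n ->
  exists i, [/\ (i < n)%N, P i & prefix_sum i <= t < prefix_sum i + f i].
Proof.
move=> t0; elim: n => [|n IH]; first by rewrite /prefix_sum big_ord0 ltNge t0.
have [h _|h] := ltP t (prefix_sum n).
  by have [i [lin Pi ti]] := IH h; exists i; split => //; exact: ltnW.
have [Pn|nPn] := boolP (P n).
  by rewrite prefix_sumS// => tn; exists n; split; rewrite ?h.
rewrite /prefix_sum big_mkcond big_ord_recr/= -big_mkcond/= (negbTE nPn) addr0.
by rewrite ltNge h.
Qed.

Lemma prefix_sum_inj i j t : P i -> P j -> prefix_sum i <= t < prefix_sum i + f i ->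
  prefix_sum j <= t < prefix_sum j + f j -> i = j.
Proof.
wlog ij : i j / (i < j)%N => [H|] Pi Pj ti tj.
  have [ij|ji|//] := ltngtP i j; first exact: H.
  by apply/esym; exact: H.
have := prefix_sum_le Pi ij.
by move: ti tj => /andP[_ h] /andP[h' _] /(lt_le_trans h); rewrite ltNge h'.
Qed.

End prefix_sums.

(** * Unrolling a weighted forest into nested intervals *)

Section forest_intervals.
Context {R : realType}.
Variables (node : nat -> pred nat) (par nchild : nat -> nat -> nat) (c : nat -> nat -> R).
Variable q : R.
Hypothesis q0 : 0 < q.
Definition is_child k a b := node k.+1 b && (par k b == a).
Hypothesis par_node : forall k b, node k (par k b).
Hypothesis nchildP : forall k a b, is_child k a b -> (b < nchild k a)%N.
Hypothesis c_gt0 : forall k a, node k a -> 0 < c k a.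
Definition childsum k a : R := \sum_(b < nchild k a | is_child k a b) c k.+1 b.
Hypothesis c_le : forall k a, node k a -> c k a <= childsum k a.
Hypothesis c_ge : forall k a, node k a -> childsum k a <= c k a / q.
Local Notation lambda := (@lebesgue_measure R).

(* The measure m_0 of the piece of [a]. *)
Fixpoint mass k a : R :=
  if k is k'.+1 then mass k' (par k' a) * (c k a / childsum k' (par k' a)) else c 0%N a.

(** Children are laid side by side in the interval of their parent, and roots along the half-line.
    Half-open intervals make pieces of one level disjoint and let the children fill their parent
    exactly. *)
Fixpoint left_end k a : R :=
  if k is k'.+1 then
    left_end k' (par k' a) + prefix_sum (is_child k' (par k' a)) (mass k) a
  else prefix_sum (node 0) (mass 0) a.

Definition piece k a : set R := [set t | node k a /\ left_end k a <= t < left_end k a + mass k a].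

Lemma childsum_gt0 k a : node k a -> 0 < childsum k a.
Proof. by move=> na; apply: lt_le_trans (c_le na); exact: c_gt0. Qed.

Lemma mass_gt0 k a : node k a -> 0 < mass k a.
Proof.
elim: k a => [|k IH] a na /=; first exact: c_gt0.
by rewrite mulr_gt0 ?IH// divr_gt0 ?c_gt0// childsum_gt0.
Qed.

Lemma child_mass_ge0 k a b : is_child k a b -> 0 <= mass k.+1 b.
Proof. by move=> /andP[nb _]; exact/ltW/mass_gt0. Qed.

Lemma sum_mass k a : node k a -> prefix_sum (is_child k a) (mass k.+1) (nchild k a) = mass k a.
Proof.
move=> na; rewrite /prefix_sum.
rewrite (eq_bigr (fun b : 'I__ => mass k a / childsum k a * c k.+1 b)); last first.
  by move=> b /andP[_ /eqP /= ->]; rewrite mulrCA [RHS]mulrC mulrA.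
by rewrite -mulr_sumr -/(childsum k a) divfK// gt_eqF// childsum_gt0.
Qed.

Lemma child_ends k a b : is_child k a b ->
  left_end k a <= left_end k.+1 b /\ left_end k.+1 b + mass k.+1 b <= left_end k a + mass k a.
Proof.
move=> ab; have /andP[nb /eqP pb] := ab.
have na : node k a by rewrite -pb.
rewrite [left_end k.+1 b]/= pb; split.
  by rewrite lerDl prefix_sum_ge0// => i; exact: child_mass_ge0.
rewrite -addrA lerD2l -(sum_mass na); apply: prefix_sum_le => //.
  by move=> i; exact: child_mass_ge0.
exact: nchildP.
Qed.

Lemma piece_node k a t : piece k a t -> node k a.
Proof. by case. Qed.

Lemma piece_child k a b : is_child k a b -> piece k.+1 b `<=` piece k a.
Proof.
move=> ab t [nb /andP[h1 h2]]; have [h3 h4] := child_ends ab.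
split; first by have /andP[_ /eqP <-] := ab.
by rewrite (le_trans h3)//= (lt_le_trans h2).
Qed.

Lemma piece_par k b t : piece k.+1 b t -> piece k (par k b) t.
Proof.
move=> h; have nb := piece_node h; apply: piece_child h.
by rewrite /is_child eqxx andbT.
Qed.

Lemma piece_split k a t : piece k a t -> exists b, is_child k a b /\ piece k.+1 b t.
Proof.
move=> [na /andP[h1 h2]].
have h3 : 0 <= t - left_end k a by rewrite subr_ge0.
have h4 : t - left_end k a < prefix_sum (is_child k a) (mass k.+1) (nchild k a).
  by rewrite sum_mass// ltrBlDl.
have [b [_ ab h]] := prefix_sum_split h3 h4.
exists b; split => //; have /andP[nb /eqP pb] := ab; split => //.
by rewrite [left_end _ _]/= pb; move: h; rewrite lerBrDl ltrBlDl addrA.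
Qed.

Lemma piece_inj k a a' t : piece k a t -> piece k a' t -> a = a'.
Proof.
elim: k a a' => [|k IH] a a' h h'.
  have [na ta] := h; have [na' ta'] := h'.
  apply: (@prefix_sum_inj _ (node 0) (mass 0) _ _ _ t) => //.
  by move=> i ni; exact/ltW/mass_gt0.
have pp := IH _ _ (piece_par h) (piece_par h').
have [na ta] := h; have [na' ta'] := h'.
pose b := par k a.
apply: (@prefix_sum_inj _ (is_child k b) (mass k.+1) _ _ _ (t - left_end k b)).
- by move=> i; exact: child_mass_ge0.
- by rewrite /is_child na eqxx.
- by rewrite /is_child na'/= /b pp.
- by move: ta; rewrite [left_end _ _]/= -/b lerBrDl ltrBlDl addrA.
- by move: ta'; rewrite [left_end _ _]/= -pp -/b lerBrDl ltrBlDl addrA.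
Qed.

(** * Branches through a point of the line and densities on them *)

Definition forest_dom : set R := \bigcup_a piece 0 a.

Definition node_at k t : nat := xget 0%N [set a | piece k a t].

Lemma node_atE k a t : piece k a t -> node_at k t = a.
Proof.
rewrite /node_at => h; case: xgetP => [b _ /= hb|/(_ a)//].
exact: piece_inj hb h.
Qed.

Lemma forest_dom_piece k a t : piece k a t -> forest_dom t.
Proof.
elim: k a => [|k IH] a h; first by exists a.
exact: IH (piece_par h).
Qed.

Lemma node_atP k t : forest_dom t -> piece k (node_at k t) t.
Proof.
move=> [a0 _ h0].
have [a ha] : exists a, piece k a t.
  elim: k => [|k [a ha]]; first by exists a0.
  by have [b [_ hb]] := piece_split ha; exists b.
by rewrite (node_atE ha).
Qed.

Lemma node_at_child k t : forest_dom t -> is_child k (node_at k t) (node_at k.+1 t).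
Proof.
move=> Dt; have h := node_atP k.+1 Dt.
by rewrite (node_atE (piece_par h)) /is_child eqxx andbT (piece_node h).
Qed.

Lemma pieceE k a : piece k a =
  if node k a then [set` `[left_end k a, left_end k a + mass k a[] else set0.
Proof.
case: ifPn => na; apply/seteqP; split => t //.
- by move=> [_]; rewrite /= in_itv.
- by case=> na'; rewrite na' in na.
Qed.

Lemma measurable_piece k a : measurable (piece k a).
Proof. by rewrite pieceE; case: ifP. Qed.

Lemma lambda_piece k a : node k a -> lambda (piece k a) = (mass k a)%:E.
Proof.
move=> na; rewrite pieceE na lebesgue_measure_itv/= lte_fin ltrDl mass_gt0//.
by rewrite -EFinB addrAC subrr add0r.
Qed.

(** The Lebesgue density that gives the piece of [a] the mass [c k a]; at level 0 it equals 1. *)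
Definition piece_density k a : R := c k a / mass k a.

(** Mass is split in proportion to [c], so all children of [a] have the density
    [childsum k a / mass k a]. Its ratio to the density of [a] is [childsum k a / c k a], which lies
    between 1 and [1 / q]. *)
Lemma piece_density_child k a b : is_child k a b ->
  piece_density k a <= piece_density k.+1 b <= piece_density k a / q.
Proof.
move=> ab; have /andP[nb /eqP pb] := ab.
have na : node k a by rewrite -pb.
have m0 := mass_gt0 na; have c0 := c_gt0 na; have cb := c_gt0 nb; have s0 := childsum_gt0 na.
have -> : piece_density k.+1 b = childsum k a / mass k a.
  by rewrite /piece_density/= pb; field; rewrite !gt_eqF.
rewrite /piece_density ler_pM2r ?invr_gt0// c_le//= mulrAC ler_pM2r ?invr_gt0//.
exact: c_ge.
Qed.

Lemma piece_density_gt0 k a : node k a -> 0 < piece_density k a.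
Proof. by move=> na; rewrite divr_gt0 ?c_gt0 ?mass_gt0. Qed.

Definition forest_density k t : R :=
  if `[< forest_dom t >] then piece_density k (node_at k t) else 0.

Lemma forest_densityE k a t : piece k a t -> forest_density k t = piece_density k a.
Proof.
move=> h; rewrite /forest_density; case: asboolP => [_|[]].
  by rewrite (node_atE h).
exact: forest_dom_piece h.
Qed.

Lemma forest_density_out k t : ~ forest_dom t -> forest_density k t = 0.
Proof. by rewrite /forest_density; case: asboolP. Qed.

Lemma forest_density_ge0 k t : 0 <= forest_density k t.
Proof.
rewrite /forest_density; case: asboolP => // Dt.
by apply/ltW/piece_density_gt0; exact: piece_node (node_atP k Dt).
Qed.

Lemma forest_density_step k t :
  forest_density k t <= forest_density k.+1 t <= forest_density k t / q.
Proof.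
rewrite /forest_density; case: asboolP => [Dt|_]; last by rewrite mul0r lexx.
exact: piece_density_child (node_at_child k Dt).
Qed.

Lemma forest_density_shift k j t :
  forest_density k t <= forest_density (k + j) t <= (q ^+ j)^-1 * forest_density k t.
Proof.
elim: j => [|j /andP[IH1 IH2]]; first by rewrite addn0 expr0 invr1 mul1r lexx.
have /andP[h1 h2] := forest_density_step (k + j) t.
rewrite addnS (le_trans IH1)//= (le_trans h2)// exprS invfM -mulrA mulrC.
by rewrite ler_pM2l// invr_gt0.
Qed.

Lemma measurable_forest_density k : measurable_fun setT (EFin \o forest_density k).
Proof.
apply/measurable_EFinP.
apply: (@measurable_fun_countable_pieces _ _ _ _ (piece k) _ (piece_density k) 0).
- exact: measurable_piece.
- by move=> a t; exact: forest_densityE.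
- by move=> t H; apply: forest_density_out => Dt; apply: (H (node_at k t)); exact: node_atP.
Qed.

Lemma EFin_forest_density_ge0 k t : (0 <= (EFin \o forest_density k) t)%E.
Proof. by rewrite lee_fin forest_density_ge0. Qed.

Definition forest_measure k : {measure set (measurableTypeR R) -> \bar R} :=
  density_measure lambda (measurable_forest_density k) (EFin_forest_density_ge0 k).

Lemma forest_measureE k A : forest_measure k A = (\int[lambda]_(t in A) (forest_density k t)%:E)%E.
Proof. by []. Qed.

Lemma forest_measure_le k j A : measurable A -> (forest_measure k A <= forest_measure (k + j) A)%E.
Proof.
move=> mA; rewrite !forest_measureE; apply: ge0_le_integral => //.
- by move=> t _; exact: EFin_forest_density_ge0.
- by apply: measurable_funTS; exact: measurable_forest_density.
- by apply: measurable_funTS; exact: measurable_forest_density.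
- by move=> t _; rewrite lee_fin; have /andP[] := forest_density_shift k j t.
Qed.

Lemma forest_measure_ge k j A : measurable A ->
  (forest_measure (k + j) A <= ((q ^+ j)^-1)%:E * forest_measure k A)%E.
Proof.
move=> mA; have qj : 0 <= (q ^+ j)^-1 by rewrite invr_ge0 exprn_ge0// ltW.
rewrite !forest_measureE -ge0_integralZl_EFin//; last 2 first.
- by move=> t _; exact: EFin_forest_density_ge0.
- by apply: measurable_funTS; exact: measurable_forest_density.
apply: ge0_le_integral => //.
- by move=> t _; exact: EFin_forest_density_ge0.
- by apply: measurable_funTS; exact: measurable_forest_density.
- by apply: measurable_funTS; apply: measurable_funeM; exact: measurable_forest_density.
- by move=> t _; rewrite lee_fin; have /andP[] := forest_density_shift k j t.
Qed.

Lemma forest_measure_pieceI k a A : measurable A ->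
  forest_measure k (A `&` piece k a) = ((piece_density k a)%:E * lambda (A `&` piece k a))%E.
Proof.
move=> mA; have mAp : measurable (A `&` piece k a).
  by apply: measurableI => //; exact: measurable_piece.
rewrite forest_measureE (eq_integral (cst (piece_density k a)%:E)).
  by rewrite integral_cst.
by move=> t; rewrite inE => -[_ /forest_densityE ->].
Qed.

Lemma forest_measure_piece k a : node k a -> forest_measure k (piece k a) = (c k a)%:E.
Proof.
move=> na; rewrite -[piece k a]setTI forest_measure_pieceI// setTI lambda_piece//.
by rewrite -EFinM /piece_density divfK// gt_eqF// mass_gt0.
Qed.

Lemma measurable_forest_dom : measurable forest_dom.
Proof. by apply: bigcup_measurable => a _; exact: measurable_piece. Qed.

Lemma forest_measure_out k A : measurable A -> A `&` forest_dom = set0 -> forest_measure k A = 0%E.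
Proof.
move=> mA AD; rewrite forest_measureE integral0_eq// => t At.
rewrite forest_density_out// => Dt.
by have : (A `&` forest_dom) t by []; rewrite AD.
Qed.

(** The density of level [k] is constant on a piece, so half of the length is half of the mass. The
    condition on [u] asks that [A] contain all points with the branch of [t]; it holds for preimages
    under a function of the branch. *)
Lemma forest_measure_density A : measurable A ->
  {ae lambda, forall t, A t -> forest_dom t ->
    (forall u, (forall k, piece k (node_at k t) u) -> A u) ->
    exists N, forall k, (N <= k)%N ->
      ((c k (node_at k t) / 2)%:E <= forest_measure k (A `&` piece k (node_at k t)))%E}.
Proof.
move=> mA; have := nested_interval_density mA.
apply: negligibleS => t /= + H; apply => At Dt Au.
pose a k := left_end k (node_at k t).
pose b k := left_end k (node_at k t) + mass k (node_at k t).
have pE k : [set u | (a k <= u < b k)%R] = piece k (node_at k t).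
  have [nk _] := node_atP k Dt.
  by apply/seteqP; split => u; rewrite /piece/=; [split|case].
have tab k : a k <= t < b k by have [] := node_atP k Dt.
have ainc : nondecreasing_seq a.
  by apply/nondecreasing_seqP => k; have [] := child_ends (node_at_child k Dt).
have bdec : nonincreasing_seq b.
  by apply/nonincreasing_seqP => k; have [] := child_ends (node_at_child k Dt).
have [|N NP] := H At a b tab ainc bdec.
  by move=> u hu; apply: Au => k; rewrite -pE; exact: hu.
exists N => k /NP; rewrite pE => h.
have [nk _] := node_atP k Dt.
rewrite forest_measure_pieceI//.
have d0 := piece_density_gt0 nk; have m0 := mass_gt0 nk.
have -> : (c k (node_at k t) / 2)%:E =
   ((piece_density k (node_at k t))%:E * ((b k - a k) / 2)%:E)%E.
  rewrite -EFinM; congr EFin; rewrite /b /a /piece_density.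
  by field; rewrite gt_eqF.
by rewrite lee_pmul2l.
Qed.

End forest_intervals.
(** The existential hides the construction of the pushforwards, of which only the values are used
    later. *)
Lemma exists_pushforward d d' (T1 : measurableType d) (T2 : measurableType d') (R : realType)
    (m : nat -> {measure set T1 -> \bar R}) (f : T1 -> T2) : measurable_fun setT f ->
  exists nu : nat -> {measure set T2 -> \bar R}, forall k A, nu k A = m k (f @^-1` A).
Proof.
move=> mf.
by exists (fun k => measure_function_pushforward__canonical__measure_function_Measure (m k) mf).
Qed.

Lemma frequently_limn_esup (R : realType) (u : (\bar R)^nat) (c : \bar R) :
  (forall n, exists k, (n <= k)%N /\ (c <= u k)%E) -> (c <= limn_esup u)%E.
Proof.
move=> H; rewrite limn_esup_lim; apply: lime_ge; first exact: is_cvg_esups.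
apply: nearW => n; have [k [nk ck]] := H n.
by apply: le_trans ck _; apply: ereal_sup_ubound; exists k.
Qed.

(** * The strongly regular sequence *)

Section branch_measures.
Context {R : realType} {dsp : measure_display} {X : measurableType dsp}.
Variables (dist : X -> X -> R) (mu : {measure set X -> \bar R}).
Variables (theta : R) (S : set X) (s : nat -> X) (kappa : R).
Hypothesis MM : metric_measure_space dist mu.
Hypothesis DB : unif_loc_doubling dist mu.
Hypothesis theta0 : 0 <= theta.
Hypothesis cS : dclosed dist S.
Hypothesis sS : forall i, S (s i).
Hypothesis s_dense : forall x, S x -> forall r, 0 < r -> exists i, dist x (s i) < r.
Hypothesis kappa0 : 0 < kappa.
Local Notation node := (node dist s).
Local Notation cut := (cut dist s mu theta).
Local Notation weight := (weight dist s mu theta).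
Hypothesis kappaP : forall k a, node k a -> kappa * weight k a <= cut k a.
Local Notation eps := (@eps R).
Local Notation cball := (cball dist).
Local Notation vol := (vol dist mu).
Local Notation q := (ratio_q theta).
Local Notation childsum := (childsum node (par dist s) (nchild dist s) cut).
Local Notation piece := (piece node (par dist s) (nchild dist s) cut).
Local Notation dom := (forest_dom node (par dist s) (nchild dist s) cut).
Local Notation node_at := (node_at node (par dist s) (nchild dist s) cut).

Lemma cut_gt0 k a : node k a -> 0 < cut k a.
Proof.
move=> na; apply: lt_le_trans (kappaP na).
by rewrite mulr_gt0// (weight_gt0 _ MM).
Qed.

Lemma cut_le_childsum k a : node k a -> cut k a <= childsum k a.
Proof. by move=> _; exact: cut_le_sum. Qed.

Lemma childsum_le_cut k a : node k a -> childsum k a <= cut k a / q.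
Proof. by move=> na; apply: sum_cut_le => //; exact/ltW/cut_gt0. Qed.

Let pn := par_node s MM.
Let nc := nchildP (s := s) MM DB.

Local Notation FM := (forest_measure pn nc cut_gt0 cut_le_childsum).

Lemma node_at_node k t : dom t -> node k (node_at k t).
Proof. by move=> /(node_atP pn nc cut_gt0 cut_le_childsum k)/piece_node. Qed.

Lemma node_at_dist k j t : dom t ->
  dist (s (node_at k t)) (s (node_at (k + j) t)) <= 2 * eps ^+ k.
Proof.
move=> Dt; elim: j k => [|j IH] k; have e0 := epsX_gt0 (R := R) k.
  by rewrite addn0 (distxx MM); lra.
have := child_dist MM (node_at_child pn nc cut_gt0 cut_le_childsum k Dt).
have := IH k.+1; rewrite addSnnS epsS.
have := dist_tri MM (s (node_at k.+1 t)) (s (node_at k t)) (s (node_at (k + j.+1) t)).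
lra.
Qed.

Lemma epsX_small (e : R) : 0 < e -> exists n, eps ^+ n < e.
Proof. by apply: exists_expr_lt; rewrite eps_gt0 eps_lt1. Qed.

Lemma epsX_anti m n : (m <= n)%N -> eps ^+ n <= eps ^+ m.
Proof. by move=> mn; apply: ler_wiXn2l mn; [exact/ltW/eps_gt0|exact/ltW/eps_lt1]. Qed.

Lemma branch_cvg t : dom t -> exists l, forall k, dist (s (node_at k t)) l <= 2 * eps ^+ k.
Proof.
move=> Dt; have [_ [compl _]] := MM.
have [|l lP] := compl (fun k => s (node_at k t)).
  move=> e e0; have [N NP] := epsX_small (divr_gt0 e0 (ltr0n R 4)).
  exists N => m n Nm Nn.
  have := node_at_dist N (m - N) Dt; have := node_at_dist N (n - N) Dt.
  rewrite !subnKC// (distC MM (s (node_at N t)) (s (node_at m t))).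
  have := dist_tri MM (s (node_at N t)) (s (node_at m t)) (s (node_at n t)).
  lra.
exists l => k; apply/ler_addgt0Pr => e e0; have [N NP] := lP e e0.
have := NP (k + N)%N (leq_addl _ _); have := node_at_dist k N Dt.
have := dist_tri MM (s (node_at (k + N) t)) (s (node_at k t)) l.
lra.
Qed.

(** The set given to [xget] depends on the branch of [t] only, so points with one branch have one
    image; (M5) relies on this. Off [dom], where all densities vanish, the value is an arbitrary
    point of [S]. *)
Definition branch_limit (t : measurableTypeR R) : X :=
  if `[< dom t >] then xget (s 0%N) [set l | forall k, dist (s (node_at k t)) l <= 2 * eps ^+ k]
  else s 0%N.

Lemma branch_limit_dist k t : dom t -> dist (s (node_at k t)) (branch_limit t) <= 2 * eps ^+ k.
Proof.
move=> Dt; rewrite /branch_limit; case: asboolP => // _.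
by case: xgetP => [l _ /(_ k)//|H]; have [l /H] := branch_cvg Dt.
Qed.

Lemma piece_dist k a t : piece k a t -> dist (s a) (branch_limit t) <= 2 * eps ^+ k.
Proof.
move=> h; have Dt := forest_dom_piece pn nc cut_gt0 cut_le_childsum h.
by have := branch_limit_dist k Dt; rewrite (node_atE pn nc cut_gt0 cut_le_childsum h).
Qed.

Lemma branch_limit_in t : S (branch_limit t).
Proof.
have [Dt|nDt] := pselect (dom t); last first.
  by rewrite /branch_limit; case: asboolP.
apply: contrapT => /cS[r [r0 rP]].
have [k kP] := epsX_small (divr_gt0 r0 (ltr0n R 4)).
apply: (rP (s (node_at k t))) (sS _) => /=; rewrite (distC MM).
by have := branch_limit_dist k Dt; lra.
Qed.

(** Within [dom], the preimage of an open set is the union of the countably many pieces whose node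
    has its ball of radius [2 * eps ^+ k] inside the set. *)
Lemma measurable_branch_limit : measurable_fun setT branch_limit.
Proof.
have [_ [_ [_ [BS _]]]] := MM.
rewrite /borel_structure in BS.
apply: (@measurability _ _ _ _ setT branch_limit (dopen dist) BS) => _ [U oU <-]; rewrite setTI.
rewrite (_ : _ @^-1` _ =
  (\bigcup_k \bigcup_(a in [set a | cball (s a) (2 * eps ^+ k) `<=` U]) piece k a) `|`
  (if `[< U (s 0%N) >] then ~` dom else set0)); last first.
  apply/seteqP; split => t /=.
    have [Dt|nDt] := pselect (dom t) => Ut; last first.
      right; move: Ut; rewrite /branch_limit; case: asboolP => // _ Us.
      by case: asboolP.
    left; have [r [r0 rP]] := oU _ Ut.
    have [k kP] := epsX_small (divr_gt0 r0 (ltr0n R 8)).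
    exists k => //; exists (node_at k t) => /=; last first.
      exact: (node_atP pn nc cut_gt0 cut_le_childsum k Dt).
    move=> y; rewrite /Defs.cball/= => hy; apply: rP => /=.
    have := branch_limit_dist k Dt.
    have := dist_tri MM (s (node_at k t)) (branch_limit t) y.
    by rewrite (distC MM (branch_limit t) (s _)); lra.
  move=> [[k _ [a /= aU /piece_dist h]]|].
    exact: aU.
  case: asboolP => // Us nDt; rewrite /branch_limit; case: asboolP => //.
apply: measurableU.
  apply: bigcup_measurable => k _; apply: bigcup_measurable => a _.
  exact: measurable_piece.
by case: ifP => // _; apply: measurableC; exact: measurable_forest_dom.
Qed.

(** * Scale estimates for the measures on [S] *)

Variable nu : nat -> {measure set X -> \bar R}.
Hypothesis nuE : forall k A, nu k A = FM k (branch_limit @^-1` A).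

Lemma measurable_preimage A : measurable A -> measurable (branch_limit @^-1` A).
Proof. by move=> mA; rewrite -[X in measurable X]setTI; exact: measurable_branch_limit. Qed.

Lemma nu_le k j A : measurable A -> (nu k A <= nu (k + j) A)%E.
Proof.
move=> /measurable_preimage mA; rewrite !nuE.
by apply: (forest_measure_le (ratio_q_gt0 theta)) => //; exact: childsum_le_cut.
Qed.

Lemma nu_ge k j A : measurable A -> (nu (k + j) A <= ((q ^+ j)^-1)%:E * nu k A)%E.
Proof.
move=> /measurable_preimage mA; rewrite !nuE.
by apply: (forest_measure_ge (ratio_q_gt0 theta)) => //; exact: childsum_le_cut.
Qed.

Lemma nu_out k A : A `&` S = set0 -> nu k A = 0%E.
Proof.
move=> AS; rewrite nuE (_ : _ @^-1` _ = set0) ?measure0//.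
apply/seteqP; split => t //= At.
have : (A `&` S) (branch_limit t) by split=> //; exact: branch_limit_in.
by rewrite AS.
Qed.

Lemma nu_node k a A : measurable A -> node k a -> cball (s a) (2 * eps ^+ k) `<=` A ->
  ((cut k a)%:E <= nu k A)%E.
Proof.
move=> mA na aA; rewrite -(forest_measure_piece pn nc cut_gt0 cut_le_childsum na) nuE.
apply: le_measure; rewrite ?inE.
- exact: measurable_piece.
- exact: measurable_preimage.
- by move=> t /piece_dist h; exact: aA.
Qed.

(** A branch with limit in the ball passes at level [j] through a node within [3 * eps ^+ j] of [x].
    The masses of these nodes are at most their weights, and their cells are disjoint and lie in the
    ball of radius [5 * eps ^+ j]. *)
Lemma nu_cball_le j x r : r <= eps ^+ j -> 
  (nu j (cball x r) <= (vol x (6 * eps ^+ j) / q ^+ j)%:E)%E.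
Proof.
move=> rj; have e0 := epsX_gt0 (R := R) j; have qj := qX_gt0 theta j.
have e6 : 0 < 6 * eps ^+ j by lra.
have mB := measurable_preimage (measurable_cball MM x r).
have mD : measurable dom by exact: measurable_forest_dom.
pose I := [set a | node j a /\ dist x (s a) <= 3 * eps ^+ j].
have -> : nu j (cball x r) = FM j ((branch_limit @^-1` cball x r) `&` dom).
  rewrite nuE; apply/eqP; rewrite eq_le; apply/andP; split; last first.
    by apply: le_measure; rewrite ?inE//; exact: measurableI.
  rewrite -[X in FM j X](setUIDK _ dom).
  have mBD : measurable ((branch_limit @^-1` cball x r) `\` dom) by exact: measurableD.
  apply: le_trans (measureU2 _ _ _) _ => //; first exact: measurableI.
  rewrite [X in (_ + X)%E](forest_measure_out pn nc cut_gt0 cut_le_childsum) ?adde0//.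
  by rewrite setDE -setIA setICl setI0.
apply: (@le_trans _ _ (((q ^+ j)^-1)%:E * \esum_(i in I) mu (cell dist s j i))%E).
  apply: (@measure_le_esum _ (measurableTypeR R) R (FM j) I (piece j)) => //.
  - by rewrite invr_ge0 ltW.
  - by move=> i _; exact: measurable_piece.
  - exact: measurableI.
  - move=> t [/= xt Dt]; exists (node_at j t); last first.
      exact: (node_atP pn nc cut_gt0 cut_le_childsum j Dt).
    split; first exact: node_at_node.
    have := branch_limit_dist j Dt; have := dist_tri MM (branch_limit t) x (s (node_at j t)).
    by rewrite (distC MM (branch_limit t)); move: xt; rewrite /Defs.cball/=; lra.
  - move=> i [ni _]; rewrite (forest_measure_piece pn nc cut_gt0 cut_le_childsum)//.
    by rewrite (mu_cell s MM theta) -EFinM lee_fin mulrCA mulVf ?mulr1 ?gt_eqF// (cut_le_weight s MM).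
rewrite mulrC EFinM lee_pmul2l//; last by rewrite lte_fin invr_gt0.
have -> : \esum_(i in I) mu (cell dist s j i) = mu (\bigcup_(i in I) cell dist s j i).
  rewrite measure_bigcup.
  - by rewrite nneseries_esum ?set_mem_set.
  - by move=> i _; exact: (measurable_cell s MM).
  - apply/trivIsetP => a b [na _] [nb _] ab; exact: (cell_disj MM).
rewrite -(volE MM)//; apply: le_measure; rewrite ?inE.
- by apply: bigcup_measurable => i _; exact: (measurable_cell s MM).
- exact: (measurable_cball MM).
- move=> y [i [_ xi] /(cell_sub MM)]; rewrite /Defs.cball/= => iy.
  by have := dist_tri MM (s i) x y; lra.
Qed.

(** The measures increase with the level, so [nu k] may be replaced by [nu j] at the level [j >= k]
    that matches [r]. *)
Lemma nu_upper : exists C : R, 0 < C /\ forall k x r, 0 < r -> r <= eps ^+ k ->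
  (nu k (cball x r) <= C%:E * codim_ratio dist mu theta x r)%E.
Proof.
(* [eps ^+ j < 40 * r], so the radius [6 * eps ^+ j] is below [240 * r]. *)
have [C [C0 CP]] := vol_doubling MM 240 DB ltr01.
exists C; split=> // k x r r0 rk.
have r1 : r <= 1 by exact: le_trans rk (epsX_le1 _).
have e01 : 0 < eps < 1 by rewrite eps_gt0 eps_lt1.
have [j /andP[jr rj]] := geometric_scale e01 r0 r1.
have kj : (k <= j)%N.
  rewrite leqNgt; apply/negP => jk; have := epsX_anti jk.
  by have := lt_le_trans jr rk; rewrite ltNge => /negP.
apply: (@le_trans _ _ (nu j (cball x r))).
  by rewrite -(subnKC kj); apply: nu_le; exact: (measurable_cball MM).
apply: le_trans (nu_cball_le x rj) _.
have rt0 : 0 < r `^ theta by rewrite powR_gt0.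
have qj := qX_gt0 theta j; have v0 := vol_gt0 MM x r0.
rewrite (codim_ratioE MM)// -EFinM lee_fin mulrA.
have h1 : vol x (6 * eps ^+ j) <= C * vol x r.
  have e0 := epsX_gt0 (R := R) j.
  by apply: CP => //; rewrite ?(distxx MM); move: jr; rewrite epsS; lra.
have h2 : r `^ theta <= q ^+ j.
  by rewrite -epsX_powR; apply: ge0_ler_powR => //; rewrite nnegrE ltW// epsX_gt0.
apply: ler_pM => //; first by rewrite ltW// (vol_gt0 MM)// mulr_gt0// epsX_gt0.
  by rewrite invr_ge0 ltW.
by rewrite lef_pV2 ?posrE.
Qed.

Lemma cut_lower k a : node k a -> kappa * (vol (s a) (eps ^+ k / 8) / q ^+ k) <= cut k a.
Proof.
move=> na; apply: le_trans (kappaP na); rewrite ler_pM2l// ler_pdivrMr ?qX_gt0//.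
exact: (weight_lower s MM).
Qed.

(** Now the level drops to some [i <= k] that matches [r]. A node of level [i] may be too far from
    [x], so one of level [i + 1] is used, whose branches all end in the ball; returning to [nu i]
    costs the factor [q]. *)
Lemma nu_lower : exists C : R, 0 < C /\ forall k x r, S x -> eps ^+ k <= r -> r <= 1 ->
  (nu k (cball x r) >= C%:E * codim_ratio dist mu theta x r)%E.
Proof.
(* The factor 16000 turns [eps ^+ i.+1 / 8] into [50 * eps ^+ i], more than [r] plus the distance to
   the node. *)
have [C [C0 CP]] := vol_doubling MM (128 * 125) DB ltr01.
exists (kappa / C); split; first exact: divr_gt0.
move=> k x r Sx kr r1.
have r0 : 0 < r by exact: lt_le_trans (epsX_gt0 k) kr.
have e01 : 0 < eps < 1 by rewrite eps_gt0 eps_lt1.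
have [i [ik ir ri]] : exists i, [/\ (i <= k)%N, eps ^+ i <= r & r <= 40 * eps ^+ i].
  have [j /andP[jr rj]] := geometric_scale e01 r0 r1.
  have [jk|kj] := ltnP j k.
    by exists j.+1; split => //; [exact: ltW|rewrite epsS; lra].
  exists k; split => //; have := epsX_anti kj; have := epsX_gt0 (R := R) k; lra.
have e0 := epsX_gt0 (R := R) i; have ei1 := epsX_le1 (R := R) i.
have [b [nb bx]] := node_dense MM s_dense i.+1 Sx.
have mB := measurable_cball MM x r.
apply: (@le_trans _ _ (nu i (cball x r))); last first.
  by rewrite -(subnKC ik); exact: nu_le.
have := nu_ge i 1 mB; rewrite addn1 expr1 => h.
have q0 := ratio_q_gt0 theta.
have {}h : (q%:E * nu i.+1 (cball x r) <= nu i (cball x r))%E.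
  by rewrite -lee_pdivlMl.
apply: le_trans h.
have : ((cut i.+1 b)%:E <= nu i.+1 (cball x r))%E.
  apply: nu_node => //; apply: (cball_sub MM); rewrite (distC MM).
  by move: bx; rewrite epsS; lra.
rewrite -(@lee_pmul2l _ q%:E)// => /(le_trans _); apply.
rewrite (codim_ratioE MM)// -!EFinM lee_fin.
have rt0 : 0 < r `^ theta by rewrite powR_gt0.
have qi := qX_gt0 theta i; have v0 := vol_gt0 MM x r0.
apply: (@le_trans _ _ (q * (kappa * (vol (s b) (eps ^+ i.+1 / 8) / q ^+ i.+1)))); last first.
  by rewrite ler_pM2l// cut_lower.
have h1 : vol x r <= C * vol (s b) (eps ^+ i.+1 / 8).
  by apply: CP => //; move: bx; rewrite ?epsS; lra.
have h2 : q ^+ i <= r `^ theta.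
  by rewrite -epsX_powR; apply: ge0_ler_powR => //; rewrite nnegrE ltW.
have -> : q * (kappa * (vol (s b) (eps ^+ i.+1 / 8) / q ^+ i.+1)) =
    kappa / C * ((C * vol (s b) (eps ^+ i.+1 / 8)) / q ^+ i).
  by set v := vol (s b) _; rewrite exprS; field; rewrite !gt_eqF.
rewrite ler_pM2l ?divr_gt0//; apply: ler_pM => //; first exact: ltW.
  by rewrite invr_ge0 ltW.
by rewrite lef_pV2 ?posrE.
Qed.

(** All the measures have the same null sets, so the support of [nu k] can be tested with the
    measure of whichever level suits the radius. *)
Lemma nu_gt0 i k A : measurable A -> (0 < nu i A -> 0 < nu k A)%E.
Proof.
move=> mA; rewrite !lt_neqAle !measure_ge0 !andbT ![0%E == _]eq_sym.
apply: contra => /eqP k0.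
have z0 : nu 0 A = 0%E.
  by apply/eqP; rewrite eq_le measure_ge0 andbT -k0 -[k]add0n nu_le.
rewrite eq_le measure_ge0 andbT -[i]add0n.
by apply: le_trans (nu_ge 0 i mA) _; rewrite z0 mule0.
Qed.

Lemma supp_nu k : supp dist (nu k) = S.
Proof.
apply/seteqP; split => x; last first.
  move=> Sx r r0; have mB := measurable_cball MM x r.
  have [i iP] := epsX_small (divr_gt0 r0 (ltr0n R 4)).
  have [a [na ax]] := node_dense MM s_dense i Sx.
  apply: (@nu_gt0 i) => //; apply: (@lt_le_trans _ _ (cut i a)%:E).
    by rewrite lte_fin cut_gt0.
  apply: nu_node => //; apply: (cball_sub MM); rewrite (distC MM).
  by have := epsX_gt0 (R := R) i; lra.
move=> suppx; apply: contrapT => /cS[r [r0 rP]].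
have := suppx _ (divr_gt0 r0 (ltr0n R 2)); rewrite nu_out ?ltxx//.
apply/seteqP; split => y // [xy Sy]; apply: (rP y) Sy => /=.
by move: xy; rewrite /Defs.cball/=; lra.
Qed.

Lemma nu_cball_lty k x r : 0 < r -> r <= eps ^+ k -> (nu k (cball x r) < +oo)%E.
Proof.
move=> r0 rk; have [C [C0 CP]] := nu_upper; apply: le_lt_trans (CP k x r r0 rk) _.
by rewrite (codim_ratioE MM)// -EFinM ltry.
Qed.

Lemma is_measure_on_nu k : is_measure_on dist (nu k).
Proof.
split.
  exists (cball (s 0%N) 1); split; first exact: (measurable_cball MM).
  have : supp dist (nu k) (s 0%N) by rewrite supp_nu.
  by move=> /(_ 1 ltr01) h; rewrite gt_eqF.
move=> x; exists (eps ^+ k); split; first exact: epsX_gt0.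
by apply: nu_cball_lty; rewrite ?epsX_gt0.
Qed.

(** * Densities and strong regularity *)

Lemma sigma_finite_nu0 : sigma_finite setT (nu 0).
Proof.
have mS := dclosed_measurable MM cS.
exists (fun i => if i is j.+1 then cball (s j) 1 else ~` S); last first.
  case=> [|j]; split.
  - exact: measurableC.
  - by rewrite nu_out ?ltry// setICl.
  - exact: (measurable_cball MM).
  - by apply: nu_cball_lty; rewrite ?expr0.
apply/seteqP; split => x // _.
have [Sx|nSx] := pselect (S x); last by exists 0%N.
have [j xj] := s_dense Sx ltr01; exists j.+1 => //.
by rewrite /Defs.cball/= (distC MM) ltW.
Qed.

(** The inequalities between [nu k] and [nu (k + j)] hold on all measurable sets, hence pass to the
    Radon-Nikodym densities almost everywhere; (M4) follows with [C3 = 1]. *)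
Lemma nu_densities : exists w : nat -> X -> R,
  (forall k, measurable_fun setT (w k)) /\
  (forall k, exists M : R, {ae nu 0, forall x, `|w k x| <= M}) /\
  (forall k A, measurable A -> nu k A = \int[nu 0]_(x in A) (w k x)%:E)%E /\
  (exists C3 : R, 0 < C3 /\ forall k j : nat, {ae nu 0, forall x, S x ->
      eps `^ (theta * j%:R) / C3 <= w k x / w (k + j)%N x <= C3}).
Proof.
have q0 := ratio_q_gt0 theta.
have qV k : 0 <= (q ^+ k)^-1 by rewrite invr_ge0 ltW// qX_gt0.
have H k : exists w : X -> R, [/\ measurable_fun setT w, forall x, 0 <= w x &
    forall A, measurable A -> (nu k A = \int[nu 0]_(x in A) (w x)%:E)%E].
  apply: (bounded_density sigma_finite_nu0 (qV k)) => A mA.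
  by have := nu_ge 0 k mA; rewrite add0n.
have [w wP] := choice H.
have mw k : measurable_fun setT (w k) by have [] := wP k.
have w0 k x : 0 <= w k x by have [] := wP k.
have wE k A : measurable A -> (nu k A = \int[nu 0]_(x in A) (w k x)%:E)%E.
  by have [_ _] := wP k; exact.
have mwE k : measurable_fun setT (EFin \o w k) by exact/measurable_EFinP.
have wle k j : {ae nu 0, forall x, ((EFin \o w k) x <= (EFin \o w (k + j)%N) x)%E}.
  apply: (ae_le_of_le_integral sigma_finite_nu0) => //.
  - by move=> x; rewrite lee_fin.
  - by move=> x; rewrite lee_fin.
  - by move=> A mA; rewrite /= -!wE// nu_le.
have wge k j : {ae nu 0, forall x,
    ((EFin \o w (k + j)%N) x <= ((q ^+ j)^-1)%:E * (EFin \o w k) x)%E}.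
  apply: (ae_le_of_le_integral sigma_finite_nu0) => //.
  - exact: measurable_funeM.
  - by move=> x; rewrite lee_fin.
  - by move=> x; rewrite lee_fin mulr_ge0.
  - move=> A mA; rewrite ge0_integralZl_EFin//.
    + by rewrite /= -!wE// nu_ge.
    + by move=> x _; rewrite lee_fin.
    + exact: measurable_funTS.
(* [w 0] is a density of [nu 0] with respect to itself, so it is 1 almost everywhere; by
   monotonicity [w k >= 1], which makes the quotients meaningful. *)
have w0ge : {ae nu 0, forall x, (cst 1%E x <= (EFin \o w 0%N) x)%E}.
  apply: (ae_le_of_le_integral sigma_finite_nu0) => //.
  - by move=> x; rewrite lee_fin.
  - by move=> A mA; rewrite integral_cst// mul1e /= -wE.
have w0le : {ae nu 0, forall x, ((EFin \o w 0%N) x <= cst 1%E x)%E}.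
  apply: (ae_le_of_le_integral sigma_finite_nu0) => //.
  - by move=> x; rewrite lee_fin.
  - by move=> A mA; rewrite integral_cst// mul1e /= -wE.
exists w; split=> //; split.
  move=> k; exists (q ^+ k)^-1; apply: filterS2 (wge 0%N k) w0le => x /=.
  rewrite add0n !lee_fin => h1 h2; rewrite ger0_norm//; apply: le_trans h1 _.
  by rewrite -[leRHS]mulr1; apply: ler_wpM2l.
split; first exact: wE.
exists 1; split=> // k j; rewrite divr1 powRrM powR_mulrn ?powR_ge0//.
have wk1 : {ae nu 0, forall x, 1 <= w k x}.
  apply: filterS2 (wle 0%N k) w0ge => x /=; rewrite add0n !lee_fin => h3 h4.
  exact: le_trans h4 h3.
apply: filterS3 (wle k j) (wge k j) wk1 => x /= h1 h2 h3 _.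
rewrite !lee_fin in h1 h2.
have wk : 0 < w k x by exact: lt_le_trans ltr01 h3.
have wkj : 0 < w (k + j)%N x by exact: lt_le_trans h1.
rewrite ler_pdivlMr// ler_pdivrMr// mul1r h1 andbT.
by rewrite -ler_pdivlMl ?qX_gt0.
Qed.

Lemma nu_strong (E : set X) : measurable E -> E `<=` S ->
  {ae nu 0, forall x, E x ->
    (0 < limn_esup (fun k : nat =>
       (fine (nu k (cball x (eps ^+ k) `&` E)) / fine (nu k (cball x (eps ^+ k))))%:E))%E}.
Proof.
move=> mE ES.
pose A := branch_limit @^-1` E.
have mA : measurable A by exact: measurable_preimage.
(* At least half of the mass of a good node sits on branches that end in [E]. *)
pose good k a := node k a /\ ((cut k a / 2)%:E <= FM k (A `&` piece k a))%E.
(* The intersection of the [G n] collects the points near good nodes of arbitrarily high level. As a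
   countable combination of balls it is measurable, with no appeal to the image of a set of
   branches. *)
pose G n := \bigcup_(k in [set k | (n <= k)%N]) \bigcup_(a in [set a | good k a])
  cball (s a) (2 * eps ^+ k).
have mG : measurable (\bigcap_n G n).
  apply: bigcap_measurable => [|n _]; first by exists 0%N.
  apply: bigcup_measurable => k _.
  by apply: bigcup_measurable => a _; exact: (measurable_cball MM).
have mEG : measurable (E `\` \bigcap_n G n) by exact: measurableD.
have EG0 : nu 0 (E `\` \bigcap_n G n) = 0%E.
  have mP := measurable_preimage mEG.
  set B := branch_limit @^-1` _ in mP.
  have mBD : measurable (B `&` dom).
    by apply: measurableI => //; exact: measurable_forest_dom.
  have mBC : measurable (B `\` dom).
    by apply: measurableD => //; exact: measurable_forest_dom.
  rewrite nuE -/B -(setUIDK B dom).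
  apply/eqP; rewrite eq_le measure_ge0 andbT.
  apply: le_trans (measureU2 _ mBD mBC) _.
  rewrite [X in (_ + X)%E](forest_measure_out pn nc cut_gt0 cut_le_childsum)//; last first.
    by rewrite setDE -setIA setICl setI0.
  suff H0 : FM 0 (B `&` dom) = 0%E by rewrite [X in (X + _)%E]H0 adde0.
  rewrite forest_measureE null_set_integral//.
    by apply: measurable_funTS; exact: (measurable_forest_density pn nc cut_gt0 cut_le_childsum).
  apply/negligibleP => //.
  have := forest_measure_density pn nc cut_gt0 cut_le_childsum mA.
  apply: negligibleS => t /= [[Et nG] Dt] H; apply: nG.
  have [|N NP] := H Et Dt.
    move=> u Hu; have Du := forest_dom_piece pn nc cut_gt0 cut_le_childsum (Hu 0%N).
    (* A point [u] in all pieces of [t] follows the same branch, so [xget] selects the same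
       limit. *)
    suff -> : A u = A t by [].
    congr E; rewrite /branch_limit; case: asboolP => // _; case: asboolP => // _.
    congr (xget _ _); apply/funext => l; apply/propext; split => h k; move: (h k);
      by rewrite (node_atE pn nc cut_gt0 cut_le_childsum (Hu k)).
  move=> n _; exists (maxn n N); first by rewrite /= leq_maxl.
  exists (node_at (maxn n N) t); last exact: branch_limit_dist.
  split; first exact: node_at_node.
  by apply: NP; exact: leq_maxr.
have [C1 [C10 C1P]] := nu_upper.
have [C [C0 CP]] := vol_doubling MM (128 * 125) DB ltr01.
(* The numerator is at least [q * cut / 2], hence at least [kappa / 2] times the ratio of volume to
   [q ^+ k] near the node; the denominator is at most [C1 * C] times that ratio. *)
pose c0 := kappa / (2 * C * C1).
have c00 : 0 < c0 by rewrite divr_gt0// !mulr_gt0.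
apply: (@negligibleS _ _ _ _ (E `\` \bigcap_n G n)); last exact/negligibleP.
move=> x /= /not_implyP[Ex nlim]; split=> // Gx; apply: nlim.
apply: (@lt_le_trans _ _ c0%:E); first by rewrite lte_fin.
apply: frequently_limn_esup => n.
(* One level is given up: a good node of level [k + 1] is compared with the ball of radius
   [eps ^+ k], which contains the limits of all its branches. Starting from [n.+1] makes the level a
   successor. *)
have [K /= nK [a [na ga] ax]] := Gx n.+1 I.
case: K nK na ga ax => // k nk na ga ax; exists k; split => //.
rewrite lee_fin.
have e0 := epsX_gt0 (R := R) k; have e1 := epsX_le1 (R := R) k.
have q0 := ratio_q_gt0 theta; have qk := qX_gt0 theta k.
have mB := measurable_cball MM x (eps ^+ k).
have mBE : measurable (cball x (eps ^+ k) `&` E) by exact: measurableI.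
have Bfin := @nu_cball_lty k x _ e0 (lexx _).
have up := C1P k x (eps ^+ k) e0 (lexx _).
have Bpos : (0 < nu k (cball x (eps ^+ k)))%E.
  have : supp dist (nu k) x by rewrite supp_nu; exact: ES.
  exact.
have lo : ((q * (cut k.+1 a / 2))%:E <= nu k (cball x (eps ^+ k) `&` E))%E.
  rewrite EFinM -lee_pdivlMl//.
  have := nu_ge k 1 mBE; rewrite addn1 expr1; apply: le_trans.
  apply: le_trans ga _; rewrite nuE; apply: le_measure; rewrite ?inE.
  - by apply: measurableI => //; exact: measurable_piece.
  - exact: measurable_preimage.
  - move=> t [At /piece_dist at_]; split => //.
    move: ax at_; rewrite /Defs.cball/= epsS.
    have := dist_tri MM (s a) x (branch_limit t); rewrite (distC MM x (s a)); lra.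
have BEfin : nu k (cball x (eps ^+ k) `&` E) \is a fin_num.
  rewrite ge0_fin_numE//; apply: le_lt_trans Bfin.
  by apply: le_measure; rewrite ?inE.
have Bf : nu k (cball x (eps ^+ k)) \is a fin_num by rewrite ge0_fin_numE.
move: lo up Bpos; rewrite (codim_ratioE MM)// -(fineK BEfin) -(fineK Bf) -EFinM.
rewrite !lee_fin lte_fin /=.
set N := fine _; set M := fine _ => lo up Mpos.
rewrite ler_pdivlMr//; apply: le_trans lo.
rewrite epsX_powR in up.
have low := cut_lower na.
have h1 : vol x (eps ^+ k) <= C * vol (s a) (eps ^+ k.+1 / 8).
  by apply: CP => //; move: ax; rewrite /Defs.cball/= ?epsS; lra.
apply: (@le_trans _ _ (c0 * (C1 * (vol x (eps ^+ k) / q ^+ k)))).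
  by rewrite ler_pM2l.
have -> : c0 * (C1 * (vol x (eps ^+ k) / q ^+ k)) = kappa / (2 * C) / q ^+ k * vol x (eps ^+ k).
  by rewrite /c0; field; rewrite !gt_eqF.
apply: (@le_trans _ _ (kappa / (2 * C) / q ^+ k * (C * vol (s a) (eps ^+ k.+1 / 8)))).
  by rewrite ler_pM2l// divr_gt0// divr_gt0// mulr_gt0.
have -> : kappa / (2 * C) / q ^+ k * (C * vol (s a) (eps ^+ k.+1 / 8)) =
   q * (kappa * (vol (s a) (eps ^+ k.+1 / 8) / q ^+ k.+1) / 2).
  by set v := vol (s a) _; rewrite exprS; field; rewrite !gt_eqF.
by rewrite ler_pM2l// ler_pM2r.
Qed.

Lemma strongly_regular_nu : strongly_regular_seq dist mu theta S eps nu.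
Proof.
split; last exact: nu_strong.
split; first by rewrite eps_gt0 eps_lt1.
split; first exact: is_measure_on_nu.
split; first exact: supp_nu.
split; first exact: nu_upper.
split; first exact: nu_lower.
exact: nu_densities.
Qed.

End branch_measures.

Lemma strongly_regular_seq_of_LCR (R : realType) (dsp : measure_display)
    (X : measurableType dsp) (dist : X -> X -> R) (mu : {measure set X -> \bar R})
    (theta : R) (S : set X) :
  metric_measure_space dist mu -> unif_loc_doubling dist mu -> 0 <= theta ->
  dclosed dist S -> S !=set0 -> LCR dist mu theta S ->
  exists (eps : R) (m : nat -> {measure set X -> \bar R}),
    strongly_regular_seq dist mu theta S eps m.
Proof.
move=> MM DB theta0 cS S0 SLCR.
have [s [sS s_dense]] := dense_sequence MM S0.
have [kappa [kappa0 kappaP]] := weight_le_cut MM DB theta0 s_dense sS SLCR.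
have [nu nuE] := exists_pushforward
  (forest_measure (par_node s MM) (nchildP MM DB) (cut_gt0 MM kappa0 kappaP)
     (@cut_le_childsum R dsp X dist mu theta s MM))
  (measurable_branch_limit MM DB kappa0 kappaP).
exists (@eps R), nu; exact: strongly_regular_nu nuE.
Qed.

Theorem theorem1 (R : realType) (dsp : measure_display) (X : measurableType dsp)
  (dist : X -> X -> R) (mu : {measure set X -> \bar R}) (p theta : R) (S : set X) :
  1 < p ->
  metric_measure_space dist mu ->
  admissible dist mu p ->
  0 <= theta ->
  dclosed dist S -> S !=set0 ->
  (LCR dist mu theta S ->
     exists (eps : R) (m : nat -> {measure set X -> \bar R}),
       strongly_regular_seq dist mu theta S eps m) /\
  ((exists (eps : R) (m : nat -> {measure set X -> \bar R}),
       regular_seq dist mu theta S eps m) ->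
     LCR dist mu theta S).
Proof.
move=> _ MM [DB _] theta0 cS S0; split; first exact: strongly_regular_seq_of_LCR.
by move=> [e [m]]; exact: LCR_of_regular_seq.
Qed.
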